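(* Let $\mathcal P_n$ be the partition monoid of degree $n$. For every integer $n\geq 2$, \[ \mathrm{Ht}(\mathrm{LCong}(\mathcal P_n))=\mathrm{Ht}(\mathrm{RCong}(\mathcal P_n))= B(n) + \sum_{r=0}^n \sum_{k=r}^n S(n,k)\binom kr\, \mathrm{Ht}(\mathrm{Sub}(\mathcal S_r)), \] and for every integer $n\geq 4$, \[ \mathrm{Ht}(\mathrm{Cong}(\mathcal P_n))=3n+1. \]
   Context: The height $\mathrm{Ht}(P)$ of a poset $P$ is the supremum of the cardinalities (numbers of elements) of chains in $P$. The partition monoid $\mathcal P_n$ consists of all set partitions of $[n]\cup[n]'$, where $[n]=\{1,\dots,n\}$ and $[n]'=\{1',\dots,n'\}$. The product $\alpha\beta$ of $\alpha,\beta\in\mathcal P_n$ is defined as follows: let $[n]''=\{1'',\dots,n''\}$ be a third copy of $[n]$; let $\alpha_1$ be the partition of $[n]\cup[n]''$ obtained from $\alpha$ by renaming each $x'$ to $x''$, and $\beta_1$ the partition of $[n]''\cup[n]'$ obtained from $\beta$ by renaming each $x\in[n]$ to $x''$; then $u,v\in[n]\cup[n]'$ are in the same block of $\alpha\beta$ if and only if they are related by the smallest equivalence relation on $[n]\cup[n]''\cup[n]'$ in which any two elements lying in a common block of $\alpha_1$ or of $\beta_1$ are related. For a semigroup $S$, a left (resp. right) congruence is an equivalence relation $\sigma$ on $S$ such that $(x,y)\in\sigma$ implies $(ax,ay)\in\sigma$ (resp. $(xa,ya)\in\sigma$) for all $a,x,y\in S$; a congruence is an equivalence relation that is both. $\mathrm{LCong}(S)$,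 $\mathrm{RCong}(S)$ and $\mathrm{Cong}(S)$ are the lattices of left, right and two-sided congruences, ordered by inclusion. $S(n,k)$ is the Stirling number of the second kind, $B(n)$ is the $n$th Bell number (the number of set partitions of $[n]$), $\mathcal S_r$ is the symmetric group of degree $r$ (with $\mathcal S_0$ trivial), and $\mathrm{Sub}(G)$ is the lattice of subgroups of a group $G$. *)

(* Defs.v *)
From HB Require Import structures.
From mathcomp Require Import all_boot all_order all_fingroup.

Set Implicit Arguments.
Unset Strict Implicit.
Unset Printing Implicit Defensive.

(* Orders every type {set T} by inclusion. *)
Export Order.DefaultSetSubsetOrder.

Local Open Scope group_scope.

(* The height of the subset X of a finite poset P, with the induced order: the
   largest number of elements (not of covering steps) of a chain in X. *)
Definition Ht (d : Order.disp_t) (P : finPOrderType d) (X : {set P}) : nat :=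
  \max_(C : {set P} |
         (C \subset X) && [forall x in C, forall y in C, (x >=< y)%O]) #|C|.

(* A relation on S is encoded as the set of pairs it relates. *)
Section Congruences.
Variables (S : finType) (mul : SemiGroup.law S).
Implicit Type E : {set S * S}.

Definition is_equivalence E : bool :=
  [&& [forall x, (x, x) \in E],
      [forall x, forall y, ((x, y) \in E) ==> ((y, x) \in E)] &
      [forall x, forall y, forall z,
         ((x, y) \in E) ==> ((y, z) \in E) ==> ((x, z) \in E)]].

Definition left_compatible E : bool :=
  [forall a, forall x, forall y, ((x, y) \in E) ==> ((mul a x, mul a y) \in E)].

Definition right_compatible E : bool :=
  [forall a, forall x, forall y, ((x, y) \in E) ==> ((mul x a, mul y a) \in E)].

Definition LCong : {set {set S * S}} :=
  [set E | is_equivalence E && left_compatible E].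

Definition RCong : {set {set S * S}} :=
  [set E | is_equivalence E && right_compatible E].

Definition Cong : {set {set S * S}} :=
  [set E | [&& is_equivalence E, left_compatible E & right_compatible E]].

End Congruences.

Definition SubG (gT : finGroupType) (G : {group gT}) : {set {set gT}} :=
  [set gval H | H in subgroups G].

Definition stirling2 (n k : nat) : nat :=
  #|[set P : {set {set 'I_n}} | partition P [set: 'I_n] && (#|P| == k)]|.

Definition bell (n : nat) : nat :=
  #|[set P : {set {set 'I_n}} | partition P [set: 'I_n]]|.

(* [n] together with [n]': inl x is x and inr x is x'. *)
Notation points n := ('I_n + 'I_n)%type.

Record partition_monoid (n : nat) := PartitionMonoid {
  blocks :> {set {set points n}};
  blocksP : partition blocks [set: points n]
}.

HB.instance Definition _ n := [isSub for @blocks n].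
HB.instance Definition _ n := [Finite of partition_monoid n by <:].

Section Product.
Variable n : nat.
Implicit Types (a b c : partition_monoid n) (u v : points n).

(* [n], [n]'' and [n]' are the left, middle and right summands. *)
Definition points3 : finType := ('I_n + 'I_n + 'I_n)%type.

Definition to_upper u : points3 :=
  match u with inl x => inl (inl x) | inr x => inl (inr x) end.

Definition to_lower u : points3 :=
  match u with inl x => inl (inr x) | inr x => inr x end.

Definition to_outer u : points3 :=
  match u with inl x => inl (inl x) | inr x => inr x end.

Definition stacked a b : {set {set points3}} :=
  [set to_upper @: (A : {set points n}) | A in blocks a]
  :|: [set to_lower @: (B : {set points n}) | B in blocks b].

Definition common_block a b : rel points3 :=
  [rel p q | [exists A in stacked a b, (p \in A) && (q \in A)]].

(* common_block is symmetric, so its reflexive transitive closure is the least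
   equivalence relation containing it. *)
Definition joined a b : rel (points n) :=
  [rel u v | connect (common_block a b) (to_outer u) (to_outer v)].

Definition mul_blocks a b : {set {set points n}} :=
  equivalence_partition (joined a b) [set: points n].

Lemma common_block_sym a b : symmetric (common_block a b).
Proof.
by move=> p q; apply: eq_existsb => A; rewrite [(p \in A) && _]andbC.
Qed.

Lemma joined_equivalence a b :
  {in [set: points n] & &, equivalence_rel (joined a b)}.
Proof.
move=> u v w _ _ _; split=> [|uv]; first exact: connect0.
exact: (same_connect (sym_connect_sym (common_block_sym a b)) uv).
Qed.

Lemma mul_blocksP a b : partition (mul_blocks a b) [set: points n].
Proof. exact/equivalence_partitionP/joined_equivalence. Qed.

Definition mul_part a b : partition_monoid n :=
  PartitionMonoid (mul_blocksP a b).

(* The blocks {x, x'}. *)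
Definition index_of u : 'I_n := match u with inl x => x | inr x => x end.

Definition one_blocks : {set {set points n}} :=
  preim_partition index_of [set: points n].

Lemma one_blocksP : partition one_blocks [set: points n].
Proof. exact: preim_partitionP. Qed.

Definition one_part : partition_monoid n := PartitionMonoid one_blocksP.

(* The monoid laws are proved through two-colourings of the points that are
   constant on blocks: they determine a partition, and those of a product are
   obtained by gluing along the middle row. *)
Definition flat a (p : pred (points n)) :=
  forall A, A \in blocks a -> {in A &, forall u v, p u = p v}.

Definition colour (f g : pred 'I_n) : pred (points n) :=
  fun u => match u with inl x => f x | inr x => g x end.

Lemma flat_eq a p q : p =1 q -> flat a p -> flat a q.
Proof. by move=> pq + A aA u v uA vA => /(_ A aA u v uA vA); rewrite !pq. Qed.

Lemma colourE p : colour (p \o inl) (p \o inr) =1 p.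
Proof. by case. Qed.

Lemma flat_pblock a b u v :
  (forall p, flat a p -> flat b p) ->
  v \in pblock (blocks b) u -> v \in pblock (blocks a) u.
Proof.
have [/and3P[/eqP cova tra _] /and3P[/eqP covb _ _]] := (blocksP a, blocksP b).
move=> sub vu; have/sub pb : flat a [in pblock (blocks a) u].
  move=> A aA w1 w2 w1A w2A /=.
  rewrite -!eq_pblock ?cova // (def_pblock tra aA w1A).
  by rewrite (def_pblock tra aA w2A).
have ub : u \in cover (blocks b) by rewrite covb inE.
have /= <- := pb _ (pblock_mem ub) u v _ vu; last by rewrite mem_pblock.
by rewrite mem_pblock cova inE.
Qed.

Lemma flat_inj a b : (forall p, flat a p <-> flat b p) -> a = b.
Proof.
move=> ab; apply: val_inj => /=.
rewrite -(equivalence_partition_pblock (blocksP a)).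
rewrite -(equivalence_partition_pblock (blocksP b)).
apply: eq_in_imset => u _; apply/setP=> v; rewrite !inE /=.
by apply/idP/idP; apply: flat_pblock => p /ab.
Qed.

Lemma flat_mul a b f g : flat (mul_part a b) (colour f g) <->
  exists2 h, flat a (colour f h) & flat b (colour h g).
Proof.
pose e := common_block a b.
have se : connect_sym e by apply/sym_connect_sym/common_block_sym.
have eU A u v : A \in blocks a -> u \in A -> v \in A ->
    connect e (to_upper u) (to_upper v).
  move=> aA uA vA; apply/connect1/existsP; exists (to_upper @: A).
  by rewrite inE !imset_f.
have eL A u v : A \in blocks b -> u \in A -> v \in A ->
    connect e (to_lower u) (to_lower v).
  move=> bA uA vA; apply/connect1/existsP; exists (to_lower @: A).
  by rewrite inE !imset_f ?orbT.
split=> [pc | [h pa pb]].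
  have jc u v : joined a b u v -> colour f g u = colour f g v.
    move=> uv; have uu : joined a b u u by apply: connect0.
    apply: (pc [set w | joined a b u w]); rewrite ?inE //.
    by apply/imsetP; exists u => //; apply/setP=> w; rewrite !inE.
  pose k (w : points3) := [exists u, connect e (to_outer u) w && colour f g u].
  have kc w1 w2 : connect e w1 w2 -> k w1 = k w2.
    move=> w12; apply: eq_existsb => u.
    by rewrite !(se (to_outer u)) (same_connect se w12).
  have kO u : k (to_outer u) = colour f g u.
    apply/existsP/idP => [[v /andP[vu]]|cu]; last by exists u; rewrite connect0.
    by rewrite (jc _ _ vu).
  exists (fun x => k (inl (inr x))) => A AP u v uA vA.
    have colU w : colour f (fun x => k (inl (inr x))) w = k (to_upper w).
      by case: w => x //; rewrite -[LHS](kO (inl x)).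
    by rewrite !colU; apply/kc/(eU A).
  have colL w : colour (fun x => k (inl (inr x))) g w = k (to_lower w).
    by case: w => x //; rewrite -[LHS](kO (inr x)).
  by rewrite !colL; apply/kc/(eL A).
pose k (w : points3) :=
  match w with inl (inl x) => f x | inl (inr x) => h x | inr x => g x end.
have ke w1 w2 : e w1 w2 -> k w1 = k w2.
  case/existsP=> A /and3P[/setUP[]/imsetP[B BP ->]].
    move=> /imsetP[u uB ->] /imsetP[v vB ->].
    by have := pa B BP u v uB vB; case: u {uB}; case: v {vB}.
  move=> /imsetP[u uB ->] /imsetP[v vB ->].
  by have := pb B BP u v uB vB; case: u {uB}; case: v {vB}.
have kc w1 w2 : connect e w1 w2 -> k w1 = k w2.
  case/connectP=> s; elim: s w1 => [|w s IHs] w1 /=; first by move=> _ ->.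
  by case/andP=> /ke-> /IHs; apply.
have kO u : k (to_outer u) = colour f g u by case: u.
move=> _ /imsetP[w _ ->] u v; rewrite !inE /= => wu wv.
by rewrite -!kO -(kc _ _ wu) -(kc _ _ wv).
Qed.

Lemma flat_one f g : flat one_part (colour f g) <-> f =1 g.
Proof.
split=> [p x | fg _ /imsetP[w _ ->] u v].
  apply: (p [set u | index_of u == x] _ (inl x) (inr x)); rewrite ?inE //.
  by apply/imsetP; exists (inl x) => //; apply/setP=> w; rewrite !inE eq_sym.
rewrite !inE /= => /eqP-> /eqP.
by case: u; case: v => x y /= ->; rewrite ?fg.
Qed.

Lemma mul_partA : associative mul_part.
Proof.
move=> a b c; apply: flat_inj => p.
suff E f g : flat (mul_part a (mul_part b c)) (colour f g) <->
             flat (mul_part (mul_part a b) c) (colour f g).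
  split=> pp; apply/(flat_eq (colourE p))/E/(flat_eq _ pp) => u;
  by rewrite colourE.
split=> /flat_mul[h].
  move=> pa /flat_mul[k pb pc].
  by apply/flat_mul; exists k => //; apply/flat_mul; exists h.
case/flat_mul=> k pa pb pc.
by apply/flat_mul; exists k => //; apply/flat_mul; exists h.
Qed.

Lemma mul_1part : left_id one_part mul_part.
Proof.
move=> a; apply: flat_inj => p.
suff E f g : flat (mul_part one_part a) (colour f g) <-> flat a (colour f g).
  split=> pp; apply/(flat_eq (colourE p))/E/(flat_eq _ pp) => u;
  by rewrite colourE.
split=> [/flat_mul[h /flat_one fh] | pa].
  by apply: flat_eq; case=> x //=.
by apply/flat_mul; exists f => //; apply/flat_one.
Qed.

Lemma mul_part1 : right_id one_part mul_part.
Proof.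
move=> a; apply: flat_inj => p.
suff E f g : flat (mul_part a one_part) (colour f g) <-> flat a (colour f g).
  split=> pp; apply/(flat_eq (colourE p))/E/(flat_eq _ pp) => u;
  by rewrite colourE.
split=> [/flat_mul[h + /flat_one hg] | pa].
  by apply: flat_eq; case=> x //=.
by apply/flat_mul; exists g => //; apply/flat_one.
Qed.

HB.instance Definition _ :=
  Monoid.isLaw.Build (partition_monoid n) one_part mul_part
    mul_partA mul_1part mul_part1.

End Product.

(* Main.v *)
Require Import Defs.
From HB Require Import structures.
From mathcomp Require Import all_boot all_order all_fingroup all_solvable.
From mathcomp Require Import zify.

(** Turning diagrams upside down is an anti-automorphism of the partition monoid,
    so left and right congruences have the same height ([Ht_LCong]).

    Right congruences. The R-class of an element is given by its upper pattern:
    a set partition of the upper row together with the set of those classes that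
    reach the lower row; the rank r is the size of that set. There are
    sum_k S(n,k) C(k,r) patterns of rank r, of which B(n) have rank 0, and each
    pattern carries a copy of S_r, the maximal subgroup of its R-class consisting
    of the elements with this upper and lower pattern ([theta]). Multiplication on
    the right keeps the upper pattern or lowers the rank ([prank_mul]). Order the
    patterns linearly by rank. To a right congruence attach, for each pattern d,
    whether the R-class of d is absorbed, that is, related to an earlier one; the
    subgroup of S_r of the elements related to the identity; and, in rank 0,
    whether the whole R-class is collapsed to a point. A strictly larger right
    congruence has a strictly larger invariant ([invariants_determine]). Pairs of
    elements move down along absorptions to a pair within one R-class that is not
    absorbed. In positive rank two such elements have equal lower patterns, because
    otherwise some right factor would lower the rank of just one of them
    ([separation]), so only the subgroup matters. In rank 0 a single identification
    already collapses the R-class ([right_row_simple]). The first R-class is never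
    absorbed, so a chain has at most B(n) - 1 + sum_d Ht(Sub(S_r)) steps. For the
    lower bound, collapse the R-classes of rank 0 one by one, then absorb all
    R-classes in their order; just before an R-class is absorbed, a chain of
    subgroups K is realised by the syntactic right congruences of the partition of
    its maximal subgroup into cosets of K ([climb_rees]).

    Two-sided congruences. Now whole J-classes are absorbed, one for each rank, and
    only one normal subgroup of S_r per positive rank remains; in rank 0 the
    invariants are whether some upper, or some lower, patterns are identified
    ([invariants_determine2]). Two-sided syntactic congruences again realise all
    steps ([climb_ideal]), so the height is 3 + sum_(r=1)^n Ht(NSub(S_r)), where
    NSub is the poset of normal subgroups. That poset has height 1, 2, 3, 4 for
    r = 1, 2, 3, 4 and 3 for larger r ([Ht_NSub_Sym]), which adds up to 3n + 1. *)

Set Implicit Arguments.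
Unset Strict Implicit.
Unset Printing Implicit Defensive.

(** * Heights and chains of finite posets *)

Section Heights.
Variables (disp : Order.disp_t) (P : finPOrderType disp).
Implicit Types (X Y C : {set P}) (x y a b c : P).
Import Order.Theory.

Definition is_chain C : bool := [forall x in C, forall y in C, (x >=< y)%O].

Lemma is_chainP C : reflect {in C &, forall x y, (x >=< y)%O} (is_chain C).
Proof.
apply: (iffP forallP) => [H x y xC yC|H x].
  by have /implyP/(_ xC)/forallP/(_ y)/implyP/(_ yC) := H x.
by apply/implyP=> xC; apply/forallP=> y; apply/implyP=> yC; apply: H.
Qed.

Lemma card_chain_Ht X C : C \subset X -> is_chain C -> #|C| <= Ht X.
Proof.
move=> sCX cC; rewrite /Ht.
by apply: (leq_bigmax_cond (F := fun C : {set P} => #|C|)); rewrite sCX.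
Qed.

Lemma Ht_attained X : exists C, [/\ C \subset X, is_chain C & #|C| = Ht X].
Proof.
have [|C /andP[sCX cC] e] := @eq_bigmax_cond _
  [pred C : {set P} | (C \subset X) && is_chain C] (fun C => #|C|).
  apply/card_gt0P; exists set0; rewrite inE /= sub0set.
  by apply/is_chainP=> x y; rewrite inE.
by exists C.
Qed.

Lemma Ht_gt0 X x : x \in X -> 0 < Ht X.
Proof.
move=> xX; rewrite -(cards1 x); apply: card_chain_Ht; first by rewrite sub1set.
by apply/is_chainP=> y z /set1P-> /set1P->; apply: comparablexx.
Qed.

Lemma Ht_sub X Y : X \subset Y -> Ht X <= Ht Y.
Proof.
move=> sXY; have [C [sCX cC <-]] := Ht_attained X.
exact: card_chain_Ht (subset_trans sCX sXY) cC.
Qed.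

(** A strictly increasing rank function is injective on chains. *)
Lemma Ht_rank_le X (f : P -> nat) N :
    {in X &, forall x y, (x < y)%O -> f x < f y} ->
    {in X, forall x, f x <= N} ->
  Ht X <= N.+1.
Proof.
move=> incr bnd; have [C [sCX /is_chainP cC <-]] := Ht_attained X.
rewrite -(card_ord N.+1) -(card_in_imset (f := fun x => inord (f x) : 'I_N.+1)).
  exact: max_card.
move=> x y xC yC; have [xX yX] := (subsetP sCX x xC, subsetP sCX y yC).
move/(congr1 (@nat_of_ord _)); rewrite !inordK ?ltnS ?bnd // => fxy.
have:= cC x y xC yC; case: comparableP => // [lt_xy|lt_yx] _.
  by have:= incr x y xX yX lt_xy; rewrite fxy ltnn.
by have:= incr y x yX xX lt_yx; rewrite fxy ltnn.
Qed.

(** Adding [y] on top of a longest chain below [x] gives a longer one, so the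
    height of the principal lower sets is a rank function. *)
Lemma Ht_below_lt X x y : x \in X -> y \in X -> (x < y)%O ->
  Ht [set z in X | (z <= x)%O] < Ht [set z in X | (z <= y)%O].
Proof.
move=> xX yX xy; have [C [/subsetP sC /is_chainP cC <-]] :=
  Ht_attained [set z in X | (z <= x)%O].
have yC : y \notin C.
  by apply/negP=> /sC; rewrite inE yX /= => yx; rewrite (lt_geF xy) in yx.
have le_y z : z \in y |: C -> (z <= y)%O.
  case/setU1P=> [->//|/sC]; rewrite inE => /andP[_ zx].
  exact: le_trans zx (ltW xy).
have -> : #|C|.+1 = #|y |: C| by rewrite cardsU1 yC.
apply: card_chain_Ht.
  apply/subsetP=> z zC; rewrite inE le_y // andbT.
  by case/setU1P: zC => [->//|/sC]; rewrite inE => /andP[].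
apply/is_chainP=> z t zC tC.
case/setU1P: (zC) => [->|zC']; first by rewrite ge_comparable ?le_y.
case/setU1P: (tC) => [->|tC']; first by rewrite le_comparable ?le_y.
exact: cC.
Qed.

(** Counting the [m] steps of a chain rather than its elements, and recording
    bounds, makes concatenation additive. *)
Definition climb X m a b : Prop :=
  exists C, [/\ C \subset X, is_chain C, {in C, forall c, (a <= c <= b)%O}
              & m < #|C|].

Lemma climb_lt_Ht X m a b : climb X m a b -> m < Ht X.
Proof. by case=> C [sCX cC _ /leq_trans]; apply; apply: card_chain_Ht. Qed.

Lemma climb_refl X a : a \in X -> climb X 0 a a.
Proof.
move=> aX; exists [set a]; split; rewrite ?sub1set ?cards1 //.
  by apply/is_chainP=> y z /set1P-> /set1P->; apply: comparablexx.
by move=> c /set1P->; rewrite lexx.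
Qed.

Lemma climb_trans X m k a b c :
  climb X m a b -> climb X k b c -> climb X (m + k) a c.
Proof.
case=> C [sC /is_chainP cC Cab Cm] [D [sD /is_chainP cD Dbc Dk]].
have CD0 : C :&: D \subset [set b].
  apply/subsetP=> z /setIP[/Cab/andP[_ zb] /Dbc/andP[bz _]].
  by rewrite inE eq_le zb.
have Cb z : z \in C -> (z <= b)%O by case/Cab/andP.
have Db z : z \in D -> (b <= z)%O by case/Dbc/andP.
have [z0 z0C] : exists z, z \in C by apply/card_gt0P; apply: leq_ltn_trans Cm.
have [z1 z1D] : exists z, z \in D by apply/card_gt0P; apply: leq_ltn_trans Dk.
have ab : (a <= b)%O by have /andP[] := Cab z0 z0C; apply: le_trans.
have bc : (b <= c)%O by have /andP[] := Dbc z1 z1D; apply: le_trans.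
exists (C :|: D); split; first by rewrite subUset sC.
- apply/is_chainP=> x y /setUP[xC|xD] /setUP[yC|yD].
  + exact: cC.
  + by rewrite le_comparable // (le_trans (Cb x _) (Db y _)).
  + by rewrite ge_comparable // (le_trans (Cb y _) (Db x _)).
  + exact: cD.
- move=> z /setUP[/Cab/andP[-> zb]|/Dbc/andP[bz ->]] /=.
    exact: le_trans zb bc.
  by rewrite andbT (le_trans ab bz).
have:= subset_leq_card CD0; rewrite cards1 cardsU; lia.
Qed.

Lemma climb_le X m a a' b : (a' <= a)%O -> climb X m a b -> climb X m a' b.
Proof.
move=> a'a [C [sC cC Cab mC]]; exists C; split=> // c /Cab/andP[ac ->].
by rewrite (le_trans a'a ac).
Qed.

Lemma climb_lt X a b : a \in X -> b \in X -> (a < b)%O -> climb X 1 a b.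
Proof.
move=> aX bX ab; exists [set a; b]; split.
- by apply/subsetP=> z /set2P[]->.
- apply/is_chainP=> x y /set2P[]-> /set2P[]->.
  - exact: comparablexx.
  - exact: lt_comparable.
  - exact: gt_comparable.
  exact: comparablexx.
- by move=> z /set2P[]->; rewrite lexx ltW.
by rewrite cards2 (lt_eqF ab).
Qed.

Lemma climb_seq X (E : nat -> P) m :
    (forall i, i <= m -> E i \in X) -> (forall i, i < m -> (E i < E i.+1)%O) ->
  climb X m (E 0) (E m).
Proof.
elim: m => [|m IHm] EX Elt; first by apply/climb_refl/EX.
rewrite -addn1; apply: (climb_trans (b := E m)).
  by apply: IHm => i /leqW; [apply: EX | apply: Elt].
by rewrite addn1; apply: climb_lt; [apply: EX | apply: EX | apply: Elt].
Qed.

End Heights.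

Lemma Ht_embed (d1 d2 : Order.disp_t) (P : finPOrderType d1)
    (Q : finPOrderType d2) (X : {set P}) (Y : {set Q}) (f : P -> Q) :
    {in X, forall x, f x \in Y} -> {in X &, injective f} ->
    {in X &, forall x y, (x <= y)%O -> (f x <= f y)%O} ->
  Ht X <= Ht Y.
Proof.
move=> fXY finj fmon; have [C [/subsetP sCX /is_chainP cC <-]] := Ht_attained X.
rewrite -(card_in_imset (f := f)) => [|x y /sCX xX /sCX yX]; last exact: finj.
apply: card_chain_Ht.
  by apply/subsetP=> _ /imsetP[x /sCX xX ->]; apply: fXY.
apply/is_chainP=> _ _ /imsetP[x xC ->] /imsetP[y yC ->].
have [xX yX] := (sCX x xC, sCX y yC).
by case/orP: (cC x y xC yC) => /fmon fle; rewrite /Order.comparable fle ?orbT.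
Qed.

Lemma ltEproper (T : finType) (A B : {set T}) : (A < B)%O = (A \proper B).
Proof. by rewrite Order.POrderTheory.lt_neqAle Order.SetSubsetOrder.leEsubset
  properEneq. Qed.

Lemma comparable_subset (T : finType) (A B : {set T}) :
  (A >=< B)%O = (A \subset B) || (B \subset A).
Proof. by rewrite /Order.comparable !Order.SetSubsetOrder.leEsubset. Qed.

(** A chain carried over from another lattice, with one more step on top. *)
Lemma climb_image (T U : finType) (X : {set {set U}}) (C : {set {set T}})
    (f : {set T} -> {set U}) (E E' : {set U}) :
    is_chain C -> E \subset E' -> E' \in X ->
    {in C, forall A : {set T}, [/\ f A \in X,
      E \subset f A & f A \proper E']} ->
    {in C &, forall A B : {set T}, A \subset B -> f A \subset f B} ->
    {in C &, injective f} ->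
  climb X #|C| E E'.
Proof.
move=> /is_chainP cC sEE' E'X fC fmon finj; exists (E' |: f @: C); split.
- rewrite subUset sub1set E'X /=.
  by apply/subsetP=> _ /imsetP[A /fC[fX _ _] ->].
- have cmp A : A \in C -> (f A >=< E')%O.
    by move=> /fC[_ _ /proper_sub sAE]; rewrite comparable_subset sAE.
  apply/is_chainP=> F1 F2 /setU1P[->|/imsetP[A AC ->]] /setU1P[->|/imsetP[B BC
    ->]].
  + by rewrite comparable_subset subxx.
  + by rewrite Order.POrderTheory.comparable_sym cmp.
  + exact: cmp.
  have := cC A B AC BC; rewrite !comparable_subset.
  by case/orP=> sAB; [rewrite (fmon A B) | rewrite (fmon B A) ?orbT].
- move=> F1 /setU1P[->|/imsetP[A /fC[_ EA /proper_sub AE'] ->]];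
    rewrite !Order.SetSubsetOrder.leEsubset.
    by rewrite sEE' subxx.
  by rewrite EA AE'.
rewrite cardsU1 card_in_imset //.
suff -> : E' \notin f @: C by [].
by apply/imsetP=> -[A /fC[_ _ AE'] e]; move: AE'; rewrite -e properxx.
Qed.


(** * The partition monoid through two-colourings *)

(** Sealed against unfolding, like the next two definitions: partitions are
    never compared by evaluating their sets of blocks. *)
HB.lock Definition pmul (n : nat) (x y : partition_monoid n) :
  partition_monoid n :=
  mul_part x y.

HB.lock Definition partition_of (n : nat) (T : eqType) (c : points n -> T) :
    partition_monoid n :=
  PartitionMonoid (preim_partitionP c [set: points n]).

HB.lock Definition linked (n : nat) (x : partition_monoid n) (u v : points n) :=
  v \in pblock (blocks x) u.

Local Notation "x ** y" := (pmul x y) (at level 40, left associativity).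

Section PartitionMonoid.
Variable n : nat.
Local Notation PM := (partition_monoid n).
Local Notation pt := (points n).
Implicit Types (x y z s t : PM) (u v w : pt) (f g h : pred 'I_n) (i j k : 'I_n).

Lemma linked_equiv x : equivalence_rel (linked x).
Proof.
move=> u v w; rewrite linked.unlock;
  have := pblock_equivalence (blocksP x) (in_setT u) (in_setT v).
exact.
Qed.

Lemma linked_refl x u : linked x u u.
Proof. by case: (linked_equiv x u u u). Qed.

Lemma linked_sym x u v : linked x u v = linked x v u.
Proof.
apply/idP/idP=> uv; first by have [_ /(_ uv) <-] := linked_equiv x u v u;
  apply: linked_refl.
by have [_ /(_ uv) <-] := linked_equiv x v u v; apply: linked_refl.
Qed.

Lemma linked_left x u v w : linked x u v -> linked x u w = linked x v w.
Proof. by move=> uv; have [_ /(_ uv) ->] := linked_equiv x u v w. Qed.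

Lemma linked_right x u v w : linked x u v -> linked x w u = linked x w v.
Proof. by move=> uv; rewrite !(linked_sym x w) (linked_left w uv). Qed.

Lemma linked_trans x u v w : linked x u v -> linked x v w -> linked x u w.
Proof. by move=> uv; rewrite (linked_left w uv). Qed.

Lemma flatP x p : flat x p <-> forall u v, linked x u v -> p u = p v.
Proof.
have /and3P[/eqP cov tr _] := blocksP x;
  split=> [px u v uv | px A Ax u v uA vA].
  by rewrite linked.unlock in uv; apply: px uv;
    rewrite ?mem_pblock ?pblock_mem // cov.
by apply: px; rewrite linked.unlock (def_pblock tr Ax uA).
Qed.

(** Blocks are flat colourings, so flat colourings detect linked points. *)
Lemma flat_linked x u : flat x (linked x u).
Proof. by apply/flatP=> v w; apply: linked_right. Qed.

Lemma linkedI x u v : (forall p, flat x p -> p u = p v) -> linked x u v.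
Proof. by move/(_ (linked x u)) <-;
  [apply: linked_refl | apply: flat_linked]. Qed.

Lemma flat_cst x b : flat x (colour (fun=> b) (fun=> b)).
Proof. by apply/flatP=> -[] ? [] ?. Qed.

Lemma flat_pmul x y f g : flat (x ** y) (colour f g) <->
  exists2 h, flat x (colour f h) & flat y (colour h g).
Proof. rewrite pmul.unlock; exact: flat_mul. Qed.

Lemma mulA x y z : x ** (y ** z) = x ** y ** z.
Proof. by rewrite pmul.unlock mul_partA. Qed.

(** ** Partitions as fibres of labellings *)

Lemma linked_of (T : eqType) (c : pt -> T) u v :
  linked (partition_of c) u v = (c u == c v).
Proof.
rewrite linked.unlock partition_of.unlock /= /preim_partition
  pblock_equivalence_partition ?inE //.
by move=> x y z _ _ _; split=> [|/eqP->].
Qed.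

Lemma flat_of (T : eqType) (c : pt -> T) p :
  flat (partition_of c) p <-> forall u v, c u = c v -> p u = p v.
Proof.
rewrite flatP; split=> pp u v; first by move=> cuv; apply: pp;
  rewrite linked_of cuv.
by rewrite linked_of => /eqP; apply: pp.
Qed.

Lemma eq_partition_of (T T' : eqType) (c : pt -> T) (c' : pt -> T') :
    (forall u v, c u = c v <-> c' u = c' v) ->
  partition_of c = partition_of c'.
Proof.
move=> cc'; apply: flat_inj => p; rewrite !flat_of.
by split=> pp u v /cc'; apply: pp.
Qed.

Definition flip (u : pt) : pt := match u with inl i => inr i | inr i =>
  inl i end.

Definition star x : PM := partition_of (fun u => pblock (blocks x) (flip u)).
Local Notation "x ^~*" := (star x) (at level 2, format "x ^~*").

Lemma linked_star x u v : linked x^~* u v = linked x (flip u) (flip v).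
Proof.
have /and3P[/eqP cov tr _] := blocksP x.
by rewrite linked_of linked.unlock eq_pblock ?cov ?inE.
Qed.

Definition up x i j := linked x (inl i) (inl j).
Definition thru x i j := linked x (inl i) (inr j).

Lemma linked_low x i j : linked x (inr i) (inr j) = up x^~* i j.
Proof. by rewrite /up linked_star. Qed.

Lemma thru_star x i j : thru x^~* i j = thru x j i.
Proof. by rewrite /thru linked_star linked_sym. Qed.

Lemma flat_colourP x f g : flat x (colour f g) <->
  [/\ forall i j, up x i j -> f i = f j,
      forall i j, up x^~* i j -> g i = g j
    & forall i j, thru x i j -> f i = g j].
Proof.
rewrite flatP; split=> [px | [pu pl pt] [i|i] [j|j] /=].
- split=> i j; first exact: px (inl i) (inl j).
    by rewrite -linked_low; apply: px (inr i) (inr j).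
  exact: px (inl i) (inr j).
- exact: pu.
- exact: pt.
- by rewrite linked_sym => /pt->.
by rewrite linked_low; apply: pl.
Qed.

Lemma partition_ext x y :
    (forall i j, up x i j = up y i j) ->
    (forall i j, up x^~* i j = up y^~* i j) ->
    (forall i j, thru x i j = thru y i j) ->
  x = y.
Proof.
move=> eu el et; apply: flat_inj => p.
suff E : flat x (colour (p \o inl) (p \o inr)) <->
         flat y (colour (p \o inl) (p \o inr)).
  by split=> pp; apply/(flat_eq (colourE p))/E/(flat_eq _ pp) => u;
    rewrite colourE.
rewrite !flat_colourP.
split=> -[pu pl pt]; split=> i j.
- by rewrite -eu; apply: pu.
- by rewrite -el; apply: pl.
- by rewrite -et; apply: pt.
- by rewrite eu; apply: pu.
- by rewrite el; apply: pl.
by rewrite et; apply: pt.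
Qed.

Lemma starK : involutive star.
Proof.
by move=> x; apply: partition_ext => i j; rewrite ?/up ?/thru !linked_star.
Qed.

Lemma flat_star x f g : flat x^~* (colour f g) <-> flat x (colour g f).
Proof.
rewrite !flat_colourP starK; split=> -[pu pl pt]; split=> // i j.
  by rewrite -thru_star => /pt.
by rewrite thru_star => /pt.
Qed.

Lemma colour_ext x y :
    (forall f g, flat x (colour f g) <-> flat y (colour f g)) -> x = y.
Proof.
move=> E; apply: flat_inj => p.
by split=> pp; apply/(flat_eq (colourE p))/E/(flat_eq _ pp) => u;
  rewrite colourE.
Qed.

Lemma starM x y : (x ** y)^~* = y^~* ** x^~*.
Proof.
apply: colour_ext => f g; rewrite flat_star !flat_pmul.
by split=> -[h]; [move=> /flat_star-? /flat_star-? |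
  move=> /flat_star-? /flat_star-?];
  exists h.
Qed.

Lemma linked_mulI x y u v :
    (forall f h g, flat x (colour f h) -> flat y (colour h g) ->
       colour f g u = colour f g v) ->
  linked (x ** y) u v.
Proof.
move=> H; apply: linkedI => p; rewrite -!(colourE p).
move/(flat_eq (fsym (colourE p)))/flat_pmul => [h px py].
exact: H px py.
Qed.

Lemma linked_mulE x y u v f h g : linked (x ** y) u v ->
  flat x (colour f h) -> flat y (colour h g) -> colour f g u = colour f g v.
Proof.
move=> uv px py; have /flatP : flat (x ** y) (colour f g).
  by apply/flat_pmul; exists h.
exact.
Qed.

Lemma up_mul x y i j : up x i j -> up (x ** y) i j.
Proof. by move=> ij; apply: linked_mulI => f h g /flat_colourP[fx _ _] _;
  apply: fx. Qed.

Lemma thru_mul x y i j k : thru x i j -> thru y j k -> thru (x ** y) i k.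
Proof.
move=> ij jk; apply: linked_mulI =>
  f h g /flat_colourP[_ _ fx] /flat_colourP[_ _ hy].
by rewrite /= (fx i j) ?(hy j k).
Qed.

(** ** Upper pattern and rank *)

Definition cls x i : {set 'I_n} := [set j | up x i j].
Definition transv x i : bool := [exists j, thru x i j].

(** The upper pattern: the traces of the blocks on the upper row, and which of
    them belong to blocks that reach the lower row. It determines the
    R-class. *)
Definition upat x : {set {set 'I_n}} * {set {set 'I_n}} :=
  ([set cls x i | i : 'I_n], [set cls x i | i : 'I_n & transv x i]).

Definition prank (d : {set {set 'I_n}} * {set {set 'I_n}}) : nat := #|d.2|.

Lemma up_refl x i : up x i i. Proof. exact: linked_refl. Qed.
Lemma up_sym x i j : up x i j = up x j i. Proof. exact: linked_sym. Qed.

Lemma cls_refl x i : i \in cls x i. Proof. by rewrite inE up_refl. Qed.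

Lemma cls_eq x i j : (cls x i == cls x j) = up x i j.
Proof.
apply/eqP/idP=> [e | ij]; first by have:= cls_refl x j; rewrite -e inE.
by apply/setP=> k; rewrite !inE; apply: linked_left.
Qed.

Lemma transv_up x i j : up x i j -> transv x i = transv x j.
Proof. by move=> ij; apply: eq_existsb => k; apply: linked_left. Qed.

Lemma transvP x i : reflect (exists j, thru x i j) (transv x i).
Proof. exact: existsP. Qed.

Lemma mem_upat1 x i : cls x i \in (upat x).1.
Proof. exact: imset_f. Qed.

Lemma mem_upat2 x i : (cls x i \in (upat x).2) = transv x i.
Proof.
apply/imsetP/idP=> [[j] | ti]; last by exists i; rewrite ?inE.
by rewrite inE => tj /eqP; rewrite cls_eq => /transv_up->.
Qed.

Lemma upatP x y : upat x = upat y <->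
  (forall i j, up x i j = up y i j) /\ (forall i, transv x i = transv y i).
Proof.
split=> [e | [eu et]].
  have ec i : cls x i = cls y i.
    have: cls x i \in (upat y).1 by rewrite -e mem_upat1.
    case/imsetP=> j _ cij; rewrite cij.
    by apply/eqP; rewrite cls_eq up_sym; have:= cls_refl x i;
      rewrite cij inE up_sym.
  split=> i; first by move=> j; have /setP/(_ j) := ec i; rewrite !inE.
  by rewrite -!mem_upat2 e ec.
have ec i : cls x i = cls y i by apply/setP=> j; rewrite !inE eu.
rewrite /upat; congr pair; first exact: eq_imset.
apply/setP=> A; apply/imsetP/imsetP => -[i /[!inE] ti ->];
  by exists i; rewrite ?ec // inE -?et // et.
Qed.

(** A colouring of two upper rows extends through [x] and its mirror image as
    soon as it is constant on the upper classes and agrees on the transversal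
    ones, which depends on the upper pattern alone. So equal upper patterns make
    [x] and [y] R-related. *)
Lemma star_cancel x y : upat x = upat y -> x ** (x^~* ** y) = y.
Proof.
case/upatP=> eu et; apply: colour_ext => f g; rewrite flat_pmul.
split=> [[h xfh /flat_pmul[k /flat_star xkh ykg]] | yfg].
  have [_ _ fh] := proj1 (flat_colourP _ _ _) xfh.
  have [_ _ kh] := proj1 (flat_colourP _ _ _) xkh.
  have [fu _ _] := proj1 (flat_colourP _ _ _) xfh.
  have [_ gl kg] := proj1 (flat_colourP _ _ _) ykg.
  apply/flat_colourP; split=> // i j; first by rewrite -eu; apply: fu.
  move=> ij; rewrite -(kg i j ij).
  have /transvP[l il] : transv x i by rewrite et; apply/transvP; exists j.
  by rewrite (fh i l il) (kh i l il).
have [fu _ _] := proj1 (flat_colourP _ _ _) yfg.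
pose h j := [exists i, thru x i j && f i].
have xfh : flat x (colour f h).
  have th i j : thru x i j -> f i = h j.
    move=> ij; apply/idP/existsP=> [fi|[k /andP[kj fk]]].
      by exists i; rewrite ij.
    rewrite (fu i k) // -eu /up; apply: linked_trans ij _.
    by rewrite linked_sym.
  apply/flat_colourP; split=> // i j; first by rewrite eu; apply: fu.
  rewrite -linked_low => ij; apply: eq_existsb => k; congr (_ && _).
  exact: linked_right.
exists h => //; apply/flat_pmul; exists f => //; exact/flat_star.
Qed.

Lemma up_mulr_nontransv x y i j : ~~ transv x i -> up (x ** y) i j -> up x i j.
Proof.
move=> ti ij.
have xi : flat x (colour (up x i) (fun=> false)).
  apply/flat_colourP; split=> // k l; first exact: linked_right.
  move=> kl; apply/negbTE/(contra _ ti) => ik; apply/transvP; exists l.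
  exact: linked_trans ik kl.
by have /= := linked_mulE ij xi (@flat_cst y false); rewrite up_refl.
Qed.

Lemma transv_mul x y i : transv (x ** y) i -> transv x i.
Proof.
case/transvP=> j ij; case: (boolP (transv x i)) => // ti.
have xi : flat x (colour (up x i) (fun=> false)).
  apply/flat_colourP; split=> // k l; first exact: linked_right.
  move=> kl; apply/negbTE/(contra _ ti) => ik; apply/transvP; exists l.
  exact: linked_trans ik kl.
by have /= := linked_mulE ij xi (@flat_cst y false); rewrite up_refl.
Qed.

(** Multiplying on the right merges and cuts transversal classes, so the rank
    drops unless nothing happens at all to the upper pattern. *)
Lemma prank_mul x y :
  prank (upat (x ** y)) <= prank (upat x) ?= iff (upat (x ** y) == upat x).
Proof.
pose T := [set cls x i | i : 'I_n & transv (x ** y) i].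
pose gl (A : {set 'I_n}) := \bigcup_(i in A) cls (x ** y) i.
have glE i : gl (cls x i) = cls (x ** y) i.
  apply/setP=> j; apply/bigcupP/idP=> [[k] | ij].
    by rewrite !inE => /(@up_mul _ y) ik; rewrite /up (linked_left _ ik).
  by exists i; rewrite ?cls_refl.
have sT : T \subset (upat x).2.
  by apply: imsetS; apply/subsetP=> i; rewrite !inE => /transv_mul.
have eT : (upat (x ** y)).2 = gl @: T.
  apply/setP=> A; apply/imsetP/imsetP=> [[i] | [_ /imsetP[i ti ->] ->]].
    by rewrite inE => ti ->; exists (cls x i); rewrite ?glE // imset_f ?inE.
  by exists i; rewrite ?glE.
have le1 : prank (upat (x ** y)) <= #|T| by rewrite /prank eT leq_imset_card.
have le2 : #|T| <= prank (upat x) by apply: subset_leq_card.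
split; first exact: leq_trans le1 le2.
apply/eqP/eqP=> [e2 | -> //].
have cT : #|gl @: T| == #|T|.
  rewrite eqn_leq leq_imset_card -eT; apply: leq_trans le2 _.
  by rewrite -e2.
have eTx : T = (upat x).2.
  by apply/eqP; rewrite eqEcard sT; apply: leq_trans le1; rewrite e2.
have tE i : transv (x ** y) i = transv x i.
  apply/idP/idP; first exact: transv_mul.
  rewrite -mem_upat2 -eTx => /imsetP[j]; rewrite inE => tj /eqP.
  by rewrite cls_eq => /(@up_mul _ y)/transv_up->.
apply/upatP; split=> // i j; apply/idP/idP; last exact: up_mul.
move=> ij; case ti: (transv x i); last exact: up_mulr_nontransv (negbT ti) ij.
have tj : transv x j by rewrite -tE -(transv_up ij) tE.
have /imset_injP injT := cT.
rewrite -cls_eq; apply/eqP/injT; rewrite ?imset_f ?inE ?tE //.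
by rewrite !glE; apply/eqP; rewrite cls_eq.
Qed.

Lemma prank_mul_le x y : prank (upat (x ** y)) <= prank (upat x).
Proof. exact: (prank_mul x y).1. Qed.

Lemma upat_mul x y : prank (upat x) <= prank (upat (x ** y)) ->
  upat (x ** y) = upat x.
Proof.
move=> le; apply/eqP; rewrite -(prank_mul x y).2 eqn_leq le andbT.
exact: prank_mul_le.
Qed.

(** Each transversal block has one trace on either row. *)
Lemma prank_star_le x : prank (upat x^~*) <= prank (upat x).
Proof.
pose gl (A : {set 'I_n}) := [set j | [exists i in A, thru x i j]].
have glE i : transv x i -> exists2 j, thru x i j & gl (cls x i) = cls x^~* j.
  case/transvP=> j ij; exists j => //; apply/setP=> k; rewrite !inE -linked_low.
  apply/existsP/idP=> [[l /andP[]] | jk].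
    by rewrite inE -(linked_left _ ij) => il; apply: linked_trans.
  by exists i; rewrite cls_refl /=; apply: linked_trans ij jk.
suff e : (upat x^~*).2 = gl @: (upat x).2 by rewrite /prank e leq_imset_card.
apply/setP=> A; apply/imsetP/imsetP=> [[j] | [_ /imsetP[i ti ->] ->]].
  rewrite inE => /transvP[i]; rewrite thru_star => ij ->.
  have ti : transv x i by apply/transvP; exists j.
  exists (cls x i); first by rewrite imset_f ?inE.
  have [j' ij' ->] := glE i ti.
  apply/eqP; rewrite cls_eq -linked_low; apply: linked_trans ij'.
  by rewrite linked_sym.
rewrite inE in ti; have [j ij ->] := glE i ti; exists j => //.
by rewrite inE; apply/transvP; exists i; rewrite thru_star.
Qed.

Lemma prank_star x : prank (upat x^~*) = prank (upat x).
Proof.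
by apply/eqP; rewrite eqn_leq prank_star_le -{1}[x]starK prank_star_le.
Qed.

End PartitionMonoid.

Local Notation "x ^~*" := (star x) (at level 2, format "x ^~*").


(** * Elements with prescribed patterns *)

Section Patterns.
Variable n : nat.
Local Notation PM := (partition_monoid n).
Local Notation pat := ({set {set 'I_n}} * {set {set 'I_n}})%type.
Implicit Types (x y z s t : PM) (f g h : pred 'I_n) (i j k : 'I_n).
Implicit Types (d e : pat) (A B : {set 'I_n}).

Definition pattern d : bool := partition d.1 [set: 'I_n] && (d.2 \subset d.1).

Local Notation blk d i := (pblock d.1 i).

Lemma blk_eq d i j : pattern d -> (blk d i == blk d j) = (j \in blk d i).
Proof.
by case/andP=> /and3P[/eqP cov tr _] _; rewrite eq_pblock // cov inE.
Qed.

Lemma blk_mem d i : pattern d -> blk d i \in d.1.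
Proof. by case/andP=> /and3P[/eqP cov _ _] _; rewrite pblock_mem ?cov ?inE. Qed.

Lemma blk_onto d A : pattern d -> A \in d.1 -> exists i, A = blk d i.
Proof.
case/andP=> /and3P[_ tr n0] _ Ad.
have /set0Pn[i iA] : A != set0 by apply: contraNneq n0 => <-.
by exists i; rewrite (def_pblock tr Ad iA).
Qed.

Lemma pattern_sub d A : pattern d -> A \in d.2 -> A \in d.1.
Proof. by case/andP=> _ /subsetP; apply. Qed.

Lemma pattern_upat x : pattern (upat x).
Proof.
apply/andP; split; last by apply: imsetS; apply/subsetP=> i; rewrite inE.
have -> : (upat x).1 = equivalence_partition (up x) [set: 'I_n].
  apply/setP=> A; apply/imsetP/imsetP=> -[i _ ->]; exists i => //;
  by apply/setP=> j; rewrite !inE.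
by apply/equivalence_partitionP=> i j k _ _ _; apply: linked_equiv.
Qed.

Lemma blk_upat x i : blk (upat x) i = cls x i.
Proof.
have /andP[/and3P[_ tr _] _] := pattern_upat x.
exact: def_pblock tr (mem_upat1 x i) (cls_refl x i).
Qed.

Lemma upat_eq x d : pattern d ->
    (forall i j, up x i j = (blk d i == blk d j)) ->
    (forall i, transv x i = (blk d i \in d.2)) ->
  upat x = d.
Proof.
move=> pd ux tx.
have cE i : cls x i = blk d i by apply/setP=> j; rewrite inE ux blk_eq.
rewrite /upat [RHS]surjective_pairing; congr pair; apply/setP=> A.
  apply/imsetP/idP=> [[i _ ->] | Ad]; first by rewrite cE blk_mem.
  by have [i ->] := blk_onto pd Ad; exists i.
apply/imsetP/idP=> [[i /[!inE] ti ->] | Ad]; first by rewrite cE -tx.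
have [i eA] := blk_onto pd (pattern_sub pd Ad).
by exists i; rewrite ?inE ?tx ?cE -?eA.
Qed.

Lemma upatE x d : upat x = d ->
  (forall i j, up x i j = (blk d i == blk d j)) /\
  (forall i, transv x i = (blk d i \in d.2)).
Proof.
move=> <-; split=> i; first by move=> j; rewrite !blk_upat cls_eq.
by rewrite blk_upat mem_upat2.
Qed.

(** When the lower pattern of [x] is the upper pattern of [y], the product is
    computed by matching transversal classes. *)
Lemma upat_comp x y : upat x^~* = upat y -> upat (x ** y) = upat x.
Proof.
move=> exy; apply: upat_mul.
suff {1}-> : x = (x ** y) ** y^~* by apply: prank_mul_le.
apply: (can_inj (@starK n)); rewrite !starM starK.
by have := star_cancel (esym exy).
Qed.

Lemma upat_comp_star x y : upat x^~* = upat y ->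
  upat (x ** y)^~* = upat y^~*.
Proof.
move=> exy; rewrite starM; apply: upat_comp.
by rewrite starK; apply: esym.
Qed.

Lemma thru_comp x y i k : upat x^~* = upat y ->
  thru (x ** y) i k = [exists j, thru x i j && thru y j k].
Proof.
move=> exy; have [eu et] := proj1 (upatP _ _) exy.
apply/idP/existsP=> [ik | [j /andP[]]]; last exact: thru_mul.
pose g k := [exists j, thru x i j && thru y j k].
have xi : flat x (colour (up x i) (thru x i)).
  apply/flat_colourP; split=> j l; [exact: linked_right| |exact: linked_right].
  by rewrite -linked_low; apply: linked_right.
have yi : flat y (colour (thru x i) g).
  have yt j l : thru y j l -> thru x i j = g l.
    move=> jl; apply/idP/existsP=> [ij | [m /andP[im ml]]].
      by exists j; rewrite ij.
    rewrite /thru -(linked_right (u := inr m)) // linked_low eu.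
    by apply: linked_trans ml _; rewrite linked_sym.
  apply/flat_colourP; split=> // j l.
    by rewrite -eu -linked_low; apply: linked_right.
  rewrite -linked_low => jl; apply: eq_existsb => m; congr (_ && _).
  exact: linked_right.
by have /= := linked_mulE ik xi yi; rewrite up_refl => /esym/existsP.
Qed.

Section Link.
Variables (d e : pat) (phi : {set 'I_n} -> {set 'I_n}).

Definition link_label (u : points n) : {set 'I_n} + {set 'I_n} :=
  match u with
  | inl i => if blk d i \in d.2 then inl (phi (blk d i)) else inr (blk d i)
  | inr j => inl (blk e j)
  end.

(** The element whose transversal blocks join the class [A] of [d] to the class
    [phi A] of [e]. *)
Definition link : PM := partition_of link_label.

Hypotheses (pd : pattern d) (pe : pattern e).
Hypotheses (phi_inj : {in d.2 &, injective phi}) (phi_im : phi @: d.2 = e.2).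

Lemma thru_link i j :
  thru link i j = (blk d i \in d.2) && (phi (blk d i) == blk e j).
Proof. by rewrite /thru linked_of /=; case: ifP. Qed.

Lemma up_link i j : up link i j = (blk d i == blk d j).
Proof.
rewrite /up linked_of /=; case: ifP => di; case: ifP => dj;
  rewrite -?(inj_eq inl_inj).
- by apply/eqP/eqP=> [[]|->] //; apply: phi_inj.
- by apply/esym/negbTE; apply: contraFneq dj => <-.
- by apply/esym/negbTE; apply: contraFneq di => ->.
- by apply/eqP/eqP=> [[]|->].
Qed.

Lemma low_link i j : up link^~* i j = (blk e i == blk e j).
Proof.
rewrite /up linked_star linked_of /=; apply/eqP/eqP=> [[] //|-> //].
Qed.

Lemma upat_link : upat link = d.
Proof.
apply: upat_eq => // [|i]; first exact: up_link.
apply/transvP/idP=> [[j] | di]; first by rewrite thru_link => /andP[].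
have [|j ej] := @blk_onto e (phi (blk d i)) pe.
  by apply: pattern_sub pe _; rewrite -phi_im imset_f.
by exists j; rewrite thru_link di ej /=.
Qed.

Lemma upat_link_star : upat link^~* = e.
Proof.
apply: upat_eq => // [|j]; first exact: low_link.
apply/transvP/idP=> [[i] | ].
  by rewrite thru_star thru_link => /andP[di /eqP <-]; rewrite -phi_im imset_f.
rewrite -phi_im => /imsetP[A Ad ej].
have [i ei] := blk_onto pd (pattern_sub pd Ad).
by exists i; rewrite thru_star thru_link -ei Ad ej /=.
Qed.

End Link.

(** Patterns of equal rank belong to one D-class. *)
Lemma connector d e : pattern d -> pattern e -> prank d = prank e ->
  exists c, upat c = d /\ upat c^~* = e.
Proof.
rewrite /prank => pd pe de.
pose phi A := nth set0 (enum e.2) (index A (enum d.2)).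
have szd : size (enum d.2) = size (enum e.2) by rewrite -!cardE.
have phi_e A : A \in d.2 -> phi A \in e.2.
  by move=> Ad; rewrite -mem_enum mem_nth // -szd index_mem mem_enum.
have phi_inj : {in d.2 &, injective phi}.
  move=> A B Ad Bd /eqP; rewrite nth_uniq ?enum_uniq -?szd ?index_mem
    ?mem_enum //.
  by move/eqP/(congr1 (nth set0 (enum d.2))); rewrite !nth_index ?mem_enum.
have phi_im : phi @: d.2 = e.2.
  apply/eqP; rewrite eqEcard card_in_imset // de leqnn andbT.
  by apply/subsetP=> _ /imsetP[A Ad ->]; apply: phi_e.
exists (link d e phi); split; [exact: upat_link | exact: upat_link_star].
Qed.

(** Every pattern is the upper pattern of a projection. *)
Definition proj d : PM := link d d id.

Lemma upat_proj d : pattern d -> upat (proj d) = d.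
Proof. by move=> pd; apply: upat_link => //; rewrite imset_id. Qed.

(** ** The symmetric group of a pattern *)

Section Theta.
Variable d : pat.
Hypothesis pd : pattern d.
Local Notation perm_d := {perm 'I_#|d.2|}.
Implicit Types (p q : perm_d) (a b : 'I_#|d.2|).

(** The action on transversal classes, extended by the identity. *)
Definition act p A : {set 'I_n} :=
  if [pick a | enum_val a == A] is Some a then enum_val (p a) else A.

Lemma act_val p a : act p (enum_val a) = enum_val (p a).
Proof.
rewrite /act; case: pickP => [b /eqP/enum_val_inj-> // | /(_ a)].
by rewrite eqxx.
Qed.

Lemma valP2 A : A \in d.2 -> exists a, A = enum_val a.
Proof. by move=> Ad; exists (enum_rank_in Ad A); rewrite enum_rankK_in. Qed.

Lemma act_in p A : A \in d.2 -> act p A \in d.2.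
Proof. by case/valP2=> a ->; rewrite act_val enum_valP. Qed.

Lemma act_inj p : {in d.2 &, injective (act p)}.
Proof.
by move=> _ _ /valP2[a ->] /valP2[b ->];
  rewrite !act_val => /enum_val_inj/perm_inj->.
Qed.

Lemma act_im p : act p @: d.2 = d.2.
Proof.
apply/eqP; rewrite eqEcard (card_in_imset (@act_inj p)) leqnn andbT.
by apply/subsetP=> _ /imsetP[A Ad ->]; apply: act_in.
Qed.

(** The isomorphism onto the maximal subgroup of the elements with upper and
    lower pattern [d]. *)
Definition theta p : PM := link d d (act p).

Lemma upat_theta p : upat (theta p) = d.
Proof. by apply: upat_link => //; [apply: act_inj | apply: act_im]. Qed.

Lemma upat_theta_star p : upat (theta p)^~* = d.
Proof. by apply: upat_link_star => //; apply: act_im. Qed.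

Lemma thru_theta p i j :
  thru (theta p) i j = (blk d i \in d.2) && (act p (blk d i) == blk d j).
Proof. exact: thru_link. Qed.

Lemma theta_ext x y : upat x = d -> upat x^~* = d -> upat y = d ->
    upat y^~* = d -> (forall i j, thru x i j = thru y i j) ->
  x = y.
Proof.
move=> ux lx uy ly; apply: partition_ext => i j.
  by rewrite (upatE ux).1 (upatE uy).1.
by rewrite (upatE lx).1 (upatE ly).1.
Qed.

Lemma thetaM p q : theta p ** theta q = theta (p * q)%g.
Proof.
have pq : upat (theta p)^~* = upat (theta q).
  by rewrite upat_theta upat_theta_star.
have ux : upat (theta p ** theta q) = d by rewrite (upat_comp pq) upat_theta.
have lx : upat (theta p ** theta q)^~* = d.
  by rewrite (upat_comp_star pq) upat_theta_star.
apply: (theta_ext ux lx (upat_theta _) (upat_theta_star _)).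
move=> i k; rewrite thru_comp // thru_theta; case di: (_ \in _) => /=;
  last first.
  by apply/existsP=> -[j]; rewrite thru_theta di.
have [a ea] := valP2 di; rewrite ea act_val permM -!act_val.
apply/existsP/eqP=> [[j] | ak].
  by rewrite !thru_theta di /= ea => /and3P[/eqP-> _ /eqP->].
have [|j ej] := @blk_onto d (act p (enum_val a)) pd.
  by apply: pattern_sub pd _; rewrite act_in ?enum_valP.
by exists j; rewrite !thru_theta di ea -ej ak act_in ?enum_valP ?eqxx.
Qed.

Lemma theta_inj : injective theta.
Proof.
move=> p q epq; apply/permP=> a.
have [i ei] := blk_onto pd (pattern_sub pd (enum_valP a)).
have [|j ej] := @blk_onto d (act p (enum_val a)) pd.
  by apply: pattern_sub pd _; rewrite act_in ?enum_valP.
have: thru (theta p) i j by rewrite thru_theta -ei -ej enum_valP eqxx.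
rewrite epq thru_theta -ei -ej => /andP[_ /eqP].
by rewrite !act_val => /enum_val_inj.
Qed.

(** Such an [x] matches the transversal classes of [d] bijectively with
    themselves. *)
Lemma theta_onto x : upat x = d -> upat x^~* = d -> exists p, x = theta p.
Proof.
move=> ux lx.
have [uE tE] := upatE ux; have [lE sE] := upatE lx.
pose R a b := [exists i, exists j,
  [&& blk d i == enum_val a, blk d j == enum_val b & thru x i j]].
have Rfun a : exists b, R a b.
  have [i ei] := blk_onto pd (pattern_sub pd (enum_valP a)).
  have /transvP[j ij] : transv x i by rewrite tE -ei enum_valP.
  have: blk d j \in d.2 by rewrite -sE; apply/transvP; exists i;
    rewrite thru_star.
  case/valP2=> b eb; exists b; apply/existsP; exists i; apply/existsP; exists j.
  by rewrite -ei -eb ij !eqxx.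
pose f a := xchoose (Rfun a).
have f_thru i j a : blk d i = enum_val a -> thru x i j ->
  blk d j = enum_val (f a).
  move=> ei ij; have /existsP[k /existsP[l /and3P[/eqP ek /eqP el kl]]] :=
    xchooseP (Rfun a).
  rewrite -el; apply/eqP; rewrite -lE -linked_low.
  apply: linked_trans kl; rewrite linked_sym; apply: linked_trans ij.
  by rewrite -/(up x k i) uE ek ei.
have f_inj : injective f.
  move=> a b eab.
  have /existsP[i /existsP[j /and3P[/eqP ei /eqP ej ij]]] := xchooseP (Rfun a).
  have /existsP[k /existsP[l /and3P[/eqP ek /eqP el kl]]] := xchooseP (Rfun b).
  apply: enum_val_inj; rewrite -ei -ek; apply/eqP; rewrite -uE.
  apply: linked_trans ij _; rewrite linked_sym; apply: linked_trans kl _.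
  by rewrite linked_low lE el ej -/(f a) eab.
exists (perm f_inj).
apply: (theta_ext ux lx (upat_theta _) (upat_theta_star _)) => i j.
rewrite thru_theta; apply/idP/andP=> [ij | [di]].
  have di : blk d i \in d.2 by rewrite -tE; apply/transvP; exists j.
  have [a ea] := valP2 di; rewrite ea act_val permE (f_thru i j a) // enum_valP.
  by split.
have [a ea] := valP2 di; rewrite ea act_val permE => /eqP fa.
have /transvP[k ik] : transv x i by rewrite tE.
apply: linked_trans (ik) _.
by rewrite linked_low lE (f_thru i k a ea ik) fa.
Qed.

End Theta.


Lemma rank0_ext x y : prank (upat x) = 0 -> upat x = upat y ->
  upat x^~* = upat y^~* -> x = y.
Proof.
move=> r0 uxy lxy; apply: partition_ext => i j.
- by have [-> _] := proj1 (upatP _ _) uxy.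
- by have [-> _] := proj1 (upatP _ _) lxy.
have nt z : upat z = upat x -> thru z i j = false.
  move=> uz; apply/negP=> ij; have : transv z i by apply/transvP; exists j.
  by rewrite (upatE uz).2 (cards0_eq r0) inE.
by rewrite !nt.
Qed.

Lemma rank0_mulr x y : prank (upat x) = 0 -> upat (x ** y) = upat x.
Proof. by move=> x0; apply: upat_mul; rewrite x0. Qed.

Lemma rank0_mull x y : prank (upat y) = 0 -> upat (x ** y)^~* = upat y^~*.
Proof. by move=> y0; rewrite starM rank0_mulr // prank_star. Qed.

Lemma prank_mul_ler x y : prank (upat (x ** y)) <= prank (upat y).
Proof. by rewrite -prank_star starM -(prank_star y); apply: prank_mul_le. Qed.

Lemma upat_mull x y : prank (upat y) <= prank (upat (x ** y)) ->
  upat (x ** y)^~* = upat y^~*.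
Proof.
by rewrite -prank_star -(prank_star (x ** y)) starM; apply: upat_mul.
Qed.

End Patterns.

Arguments theta {n} d p.


(** * Separating patterns *)

Section Separation.
Variable n : nat.
Local Notation PM := (partition_monoid n).
Implicit Types (x y z s t : PM) (f g h : pred 'I_n) (i j k l : 'I_n).
Implicit Types (I J : {set 'I_n}).

Definition independent x I : Prop := {in I &, forall i j, up x i j -> i = j}.

Lemma prank_ge x I : {in I, forall i, transv x i} -> independent x I ->
  #|I| <= prank (upat x).
Proof.
move=> tI uI; rewrite -(card_in_imset (f := cls x)); last first.
  by move=> i j iI jI /eqP; rewrite cls_eq; apply: uI.
by apply/subset_leq_card/subsetP=> _ /imsetP[i iI ->]; rewrite mem_upat2 tI.
Qed.

Lemma prank_le x J :
    (forall i, transv x i -> exists2 j, j \in J & up x i j) ->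
  prank (upat x) <= #|J|.
Proof.
move=> tJ; apply: leq_trans (leq_imset_card (cls x) J).
apply/subset_leq_card/subsetP=> _ /imsetP[i /[!inE] /tJ[j jJ ij] ->].
by apply/imsetP; exists j => //; apply/eqP; rewrite cls_eq.
Qed.

Definition transversal x I : Prop :=
  [/\ {in I, forall i, transv x i}, independent x I & #|I| = prank (upat x)].

(** The classes of [i] and [j] are represented by these two points, every other
    transversal class by an arbitrary member. *)
Lemma transversal_ex x i j : transv x i -> transv x j -> (up x i j -> i = j) ->
  exists I, [/\ i \in I, j \in I & transversal x I].
Proof.
move=> ti tj ij.
pose rep k := if up x i k then i else if up x j k then j else
              odflt k [pick l in cls x k].
have rep_up k : up x k (rep k).
  rewrite /rep; case: ifP => [|_]; first by rewrite up_sym.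
  case: ifP => [|_]; first by rewrite up_sym.
  by case: pickP => [l|_] /=; rewrite ?inE ?up_refl.
have rep_eq k l : up x k l -> rep k = rep l.
  move=> kl; rewrite /rep !(linked_right _ kl : up x _ k = up x _ l).
  have /eqP-> : cls x k == cls x l by rewrite cls_eq.
  case: (up x i l) => //; case: (up x j l) => //.
  by case: pickP => // /(_ l); rewrite cls_refl.
have tr k : transv x (rep k) = transv x k by rewrite -(transv_up (rep_up k)).
exists (rep @: [set k | transv x k]).
have iI : i \in rep @: [set k | transv x k].
  by apply/imsetP; exists i; rewrite ?inE // /rep up_refl.
have jI : j \in rep @: [set k | transv x k].
  apply/imsetP; exists j; rewrite ?inE // /rep up_refl.
  by case: ifP => // /ij.
split=> //; split.
- by move=> _ /imsetP[k /[!inE] tk ->]; rewrite tr.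
- move=> _ _ /imsetP[k _ ->] /imsetP[l _ ->] kl; apply: rep_eq.
  apply: linked_trans (rep_up k) _; apply: linked_trans kl _.
  by rewrite linked_sym; apply: rep_up.
apply/eqP; rewrite eqn_leq; apply/andP; split.
  apply: prank_ge; first by move=> _ /imsetP[k /[!inE] tk ->]; rewrite tr.
  move=> _ _ /imsetP[k _ ->] /imsetP[l _ ->] kl; apply: rep_eq.
  apply: linked_trans (rep_up k) _; apply: linked_trans kl _.
  by rewrite linked_sym; apply: rep_up.
by apply: prank_le => k tk; exists (rep k); rewrite ?imset_f ?inE ?rep_up.
Qed.

Section Gate.
Variables (I : {set 'I_n}) (tau e : 'I_n -> 'I_n).

(** The element linking each upper point [i] of [I] to the lower point [tau i],
    isolating the other upper points, and identifying lower points along the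
    fibres of [e]. *)
Definition gate : PM := partition_of (fun u : points n =>
  match u with
  | inl i => if i \in I then inl (e (tau i)) else inr i
  | inr j => inl (e j)
  end : 'I_n + 'I_n).

Lemma flat_gate f h : (forall j l, e j = e l -> h j = h l) ->
  {in I, forall i, f i = h (tau i)} -> flat gate (colour f h).
Proof.
move=> he fh; apply/flat_of=> -[i|j] [k|l] /=; do ?case: ifP => //.
- by move=> kI iI [/he]; rewrite !fh.
- by move=> _ _ [->].
- by move=> iI [/he]; rewrite fh.
- by move=> kI [/he]; rewrite fh.
by case=> /he.
Qed.

Lemma gate_low f h j l : flat gate (colour f h) -> e j = e l -> h j = h l.
Proof. by move=> /flat_of/(_ (inr j) (inr l)) /= + ejl; rewrite ejl; apply. Qed.

Lemma gate_thru f h i : flat gate (colour f h) -> i \in I -> f i = h (tau i).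
Proof. by move=> /flat_of/(_ (inl i) (inr (tau i))) /= + iI; rewrite iI;
  apply. Qed.

Lemma transv_gate x i : transv (gate ** x) i -> i \in I.
Proof.
case/transvP=> j ij; apply/negPn/negP=> iI.
have gi : flat gate (colour (pred1 i) (fun=> false)).
  by apply: flat_gate => // k kI; apply: contraNF iI => /eqP <-.
by have /= := linked_mulE ij gi (@flat_cst _ x false); rewrite eqxx.
Qed.

End Gate.

Definition separates s x y : Prop :=
  prank (upat (s ** x)) = prank (upat x) /\
  prank (upat (s ** y)) < prank (upat y).

(** The partial identity on a transversal of [x] keeps the rank of [x], while in
    [y] all the points of the transversal but one already meet every class that
    stays transversal. *)
Lemma separate_restrict x y I i : transversal x I ->
    prank (upat x) = prank (upat y) -> i \in I ->
    {in I, forall k, transv y k -> exists2 l, l \in I :\ i & up y k l} ->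
  separates (gate I id id) x y.
Proof.
move=> [tI uI cI] rxy iI yI; split.
  apply/eqP; rewrite eqn_leq prank_mul_ler /=.
  rewrite -cI; apply: prank_ge => [k kI | k l kI lI kl].
    have /transvP[j kj] := tI k kI; apply/transvP; exists j.
    apply: linked_mulI => f h g sf /flat_colourP[_ _ xt] /=.
    by rewrite (gate_thru sf) ?(xt k j).
  apply: uI => //.
  have xk : flat x (colour (up x k) (thru x k)) by
    apply/flat_colourP; split=> a b; rewrite -?linked_low; apply: linked_right.
  have gk : flat (gate I id id) (colour (up x k) (up x k)).
    by apply: flat_gate => // a b ->.
  by have /= := linked_mulE kl gk xk; rewrite up_refl.
rewrite -rxy -cI; apply: (@leq_trans #|I :\ i|.+1);
  last by rewrite (cardsD1 i I) iI.
rewrite ltnS; apply: prank_le => k tk; have kI := transv_gate tk.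
have tyk : transv y k.
  case/transvP: tk => j kj; case: (boolP (transv y k)) => // ntk.
  have yk : flat y (colour (up y k) (fun=> false)).
    apply/flat_colourP; split=> // a b; first exact: linked_right.
    move=> ab; apply/negbTE/(contra _ ntk) => ka; apply/transvP; exists b.
    exact: linked_trans ka ab.
  have gk : flat (gate I id id) (colour (up y k) (up y k)).
    by apply: flat_gate => // a b ->.
  by have /= := linked_mulE kj gk yk; rewrite up_refl.
have [l lI kl] := yI k kI tyk; exists l => //; apply: linked_mulI => f h g sf.
move=> /flat_colourP[yh _ _] /=.
by rewrite !(gate_thru sf) ?(yh k l) //; case/setD1P: lI.
Qed.

(** If the patterns differ away from the transversal classes, a transversal
    class [a] is made to leave through [j] and re-enter through [i]: this keeps
    it connected exactly when [i] and [j] are. *)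
Lemma separate_reroute x y i j a :
    (forall k, transv x k = transv y k) -> prank (upat x) = prank (upat y) ->
    ~~ transv x i -> ~~ transv x j -> transv x a -> up x i j -> ~~ up y i j ->
  exists s, separates s x y.
Proof.
move=> txy rxy ti tj ta ij nij.
have [|I [aI _ [tI uI cI]]] := @transversal_ex x a a ta ta; first by [].
have iI : i \notin I by apply: contra ti; apply: tI.
have jI : j \notin I by apply: contra tj; apply: tI.
pose tau k := if k == a then j else k; pose e k := if k == a then i else k.
exists (gate I tau e).
have ai : a != i by apply: contraNneq iI => <-.
have eP h : h a = h i -> forall k l, e k = e l -> h k = h l.
  move=> hai k l; rewrite /e.
  by case: eqP => [->|_]; case: eqP => [->|_] // kl;
    [rewrite -kl | rewrite kl | rewrite kl].
have ea : e a = e i by rewrite /e eqxx (eq_sym i) (negbTE ai).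
split.
  apply/eqP; rewrite eqn_leq prank_mul_ler /=.
  rewrite -cI; apply: prank_ge => [k kI | k l kI lI kl].
    have /transvP[m km] := tI k kI; apply/transvP; exists m.
    apply: linked_mulI => f h g sf /flat_colourP[xh _ xt] /=.
    rewrite (gate_thru sf) // /tau; case: eqP => [eka | _]; last exact: xt.
    by rewrite -(xh i j ij) -(gate_low sf ea) -eka; apply: xt.
  apply/eqP; case: (eqVneq k l) => // nkl.
  (* one of the two points differs from [a], and its class is cut out *)
  have [m [mkl ma]] : exists m, (m == k) || (m == l) /\ m != a.
    have [ka|ka] := eqVneq k a; last by exists k; rewrite eqxx.
    by exists l; rewrite eqxx orbT -ka eq_sym.
  have mI : m \in I by case/orP: mkl => /eqP->.
  have hI b : b \in I -> up x m b = (m == b).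
    by move=> bI; apply/idP/eqP=> [|->]; [apply: uI | apply: up_refl].
  have xm : flat x (colour (up x m) (thru x m)) by
    apply/flat_colourP; split=> b c; rewrite -?linked_low; apply: linked_right.
  have nt b : ~~ transv x b -> up x m b = false.
    by move=> tb; apply: contraNF tb => /transv_up<-; apply: tI.
  have gm : flat (gate I tau e) (colour (fun b => (m == b)) (up x m)).
    apply: flat_gate; first by apply: eP; rewrite hI // (negbTE ma) nt.
    move=> b bI /=; rewrite /tau; case: (b =P a) => [->|_]; last by rewrite hI.
    by rewrite (negbTE ma) nt.
  have /= := linked_mulE kl gm xm.
  by case/orP: mkl => /eqP->; rewrite eqxx ?(eq_sym l) (negbTE nkl).
rewrite -rxy -cI; apply: (@leq_trans #|I :\ a|.+1);
  last by rewrite (cardsD1 a I) aI.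
rewrite ltnS; apply: prank_le => k tk; have kI := transv_gate tk.
exists k; last exact: up_refl.
rewrite !inE kI andbT; apply: contraL tk => /eqP->.
apply/negP=> /transvP[b ab].
have yj : flat y (colour (up y j) (fun=> false)).
  apply/flat_colourP; split=> // c d; first exact: linked_right.
  move=> cd; rewrite txy in tj; apply/negbTE/(contra _ tj) => jc.
  by apply/transvP; exists d; apply: linked_trans jc cd.
have ya : up y j a = false.
  by rewrite txy in tj; apply: contraNF tj => /transv_up->; rewrite -txy.
have gj : flat (gate I tau e) (colour (fun b => (b == a)) (up y j)).
  apply: flat_gate; first by apply: eP; rewrite ya up_sym (negbTE nij).
  move=> c c_I /=; rewrite /tau; case: eqP => [_|ca]; first by rewrite up_refl.
  rewrite txy in tj; apply/esym/negbTE/(contra _ tj) => jc.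
  by rewrite (transv_up jc) -txy tI.
by have /= := linked_mulE ab gj yj; rewrite eqxx.
Qed.

(** A partial identity separates [x] and [y] if a point is transversal in only
    one of them, or if two transversal points are linked in only one of them;
    otherwise the patterns differ among nontransversal points, and rerouting a
    transversal class through these separates. It takes a positive rank to have
    such a class. *)
Lemma separation x y : prank (upat x) = prank (upat y) -> 0 < prank (upat x) ->
  upat x <> upat y -> exists s, separates s x y \/ separates s y x.
Proof.
move=> rxy r0 nxy.
have half1 z t : prank (upat z) = prank (upat t) ->
    (exists2 i, transv z i & ~~ transv t i) -> exists s, separates s z t.
  move=> rzt [i zi ti].
  have [|I [iI _ trI]] := @transversal_ex z i i zi zi; first by [].
  exists (gate I id id); apply: separate_restrict trI rzt iI _ => k kI tk.
  by exists k; rewrite ?up_refl // !inE kI andbT; apply: contraTneq tk => ->.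
have [/existsP[i] | /existsPn tE] :=
    boolP [exists i, transv x i != transv y i].
  case xi: (transv x i) => yi.
    by have [|s] := @half1 x y rxy; [exists i;
      rewrite // -eqbF_neg eq_sym | exists s; left].
  have [|s] := @half1 y x (esym rxy); last by exists s; right.
  by exists i; rewrite ?xi //; case: (transv y i) yi.
have {}tE i : transv x i = transv y i by have := tE i; rewrite negbK => /eqP.
have half2 z t : prank (upat z) = prank (upat t) ->
    (exists i, exists j, [/\ transv z i, transv z j, ~~ up z i j & up t i j]) ->
  exists s, separates s z t.
  move=> rzt [i [j [zi zj nzij tij]]].
  have [|I [iI jI trI]] := @transversal_ex z i j zi zj;
    first by rewrite (negbTE nzij).
  exists (gate I id id); apply: separate_restrict trI rzt iI _ => k kI _.
  have [-> | ki] := eqVneq k i; last by exists k; rewrite ?up_refl // !inE ki.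
  exists j => //; rewrite !inE jI andbT; apply: contraNneq nzij => ->.
  exact: up_refl.
have [i [j ij]] : exists i, exists j, up x i j <> up y i j.
  case: (boolP [exists i, exists j, up x i j != up y i j]).
    by case/existsP=> i /existsP[j /eqP]; exists i, j.
  move/existsPn=> H; case: nxy; apply/upatP; split=> // i j.
  by have /existsPn/(_ j) := H i; rewrite negbK => /eqP.
have half3 z t : prank (upat z) = prank (upat t) -> 0 < prank (upat z) ->
    (forall k, transv z k = transv t k) -> up z i j -> ~~ up t i j ->
  exists s, separates s z t \/ separates s t z.
  move=> rzt z0 tzt zij tij; have zij' := transv_up zij.
  case zi: (transv z i).
    have [|s] := @half2 t z (esym rzt); last by exists s; right.
    by exists i, j; rewrite -!tzt -zij' zi.
  have /card_gt0P[A] := z0; case/imsetP=> a za _.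
  rewrite inE in za; have zj : ~~ transv z j by rewrite -zij' zi.
  have [s ss] := separate_reroute tzt rzt (negbT zi) zj za zij tij.
  by exists s; left.
case xij: (up x i j) ij; case yij: (up y i j) => // _.
  by apply: half3; rewrite ?xij ?yij.
have [s [] ss] : exists s, separates s y x \/ separates s x y.
- by apply: half3; rewrite ?xij ?yij -?rxy.
- by exists s; right.
by exists s; left.
Qed.

End Separation.


(** * Congruences as relations *)

Section Congruences.
Variable n : nat.
Local Notation PM := (partition_monoid n).
Implicit Types (x y z w s t : PM) (i j : 'I_n) (E F : {set PM * PM}).

Definition eqv E : Prop :=
  [/\ forall x, (x, x) \in E, forall x y, (x, y) \in E -> (y, x) \in E
    & forall x y z, (x, y) \in E -> (y, z) \in E -> (x, z) \in E].
Definition lcomp E : Prop := forall a x y, (x, y) \in E ->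
  (a ** x, a ** y) \in E.
Definition rcomp E : Prop := forall a x y, (x, y) \in E ->
  (x ** a, y ** a) \in E.

Lemma eqvP E : reflect (eqv E) (is_equivalence E).
Proof.
apply: (iffP and3P) => -[].
  move=> /forallP rE /forallP sE /forallP tE; split=> // x y.
    by have /forallP/(_ y)/implyP := sE x.
  by move=> z xy yz; have /forallP/(_ y)/forallP/(_ z)/implyP/(_ xy)/implyP :=
    tE x; apply.
move=> rE sE tE; split; apply/forallP=> x //; apply/forallP=> y.
  by apply/implyP; apply: sE.
by apply/forallP=> z; apply/implyP=> xy; apply/implyP; apply: tE.
Qed.

Lemma lcompP E : reflect (lcomp E) (left_compatible (@mul_part n) E).
Proof.
rewrite /lcomp pmul.unlock; apply: (iffP forallP) => [H a x y xy | H a].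
  by have /forallP/(_ x)/forallP/(_ y)/implyP := H a; apply.
by apply/forallP=> x; apply/forallP=> y; apply/implyP; apply: H.
Qed.

Lemma rcompP E : reflect (rcomp E) (right_compatible (@mul_part n) E).
Proof.
rewrite /rcomp pmul.unlock; apply: (iffP forallP) => [H a x y xy | H a].
  by have /forallP/(_ x)/forallP/(_ y)/implyP := H a; apply.
by apply/forallP=> x; apply/forallP=> y; apply/implyP; apply: H.
Qed.

Lemma LCongP E : reflect (eqv E /\ lcomp E) (E \in LCong (@mul_part n)).
Proof. by rewrite inE; apply: (iffP andP) => -[/eqvP ? /lcompP]. Qed.

Lemma RCongP E : reflect (eqv E /\ rcomp E) (E \in RCong (@mul_part n)).
Proof. by rewrite inE; apply: (iffP andP) => -[/eqvP ? /rcompP]. Qed.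

Lemma CongP E : reflect [/\ eqv E,
  lcomp E & rcomp E] (E \in Cong (@mul_part n)).
Proof. by rewrite inE; apply: (iffP and3P) => -[/eqvP ? /lcompP ? /rcompP]. Qed.

(** ** Duality *)

Definition dual E : {set PM * PM} := [set p | (p.1^~*, p.2^~*) \in E].

Lemma dualE E x y : ((x, y) \in dual E) = ((x^~*, y^~*) \in E).
Proof. by rewrite inE. Qed.

Lemma dualK : involutive dual.
Proof. by move=> E; apply/setP=> -[x y]; rewrite !dualE !starK. Qed.

Lemma eqv_dual E : eqv E -> eqv (dual E).
Proof.
case=> rE sE tE; split=> [x|x y|x y z]; rewrite !dualE //; first exact: sE.
exact: tE.
Qed.

Lemma lcomp_dual E : rcomp E -> lcomp (dual E).
Proof. by move=> cE a x y; rewrite !dualE !starM; apply: cE. Qed.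

Lemma rcomp_dual E : lcomp E -> rcomp (dual E).
Proof. by move=> cE a x y; rewrite !dualE !starM; apply: cE. Qed.

Lemma dual_sub E F : E \subset F -> dual E \subset dual F.
Proof. by move/subsetP=> sEF; apply/subsetP=> -[x y]; rewrite !dualE;
  apply: sEF. Qed.

Lemma Ht_LCong : Ht (LCong (@mul_part n)) = Ht (RCong (@mul_part n)).
Proof.
apply/eqP; rewrite eqn_leq; apply/andP; split;
  apply: (@Ht_embed _ _ _ _ _ _ dual) => [E||E F _ _]; try exact: dual_sub;
  try by (move=> E F _ _; apply: (can_inj dualK)).
  by move=> /LCongP[eE cE]; apply/RCongP; split;
    [apply: eqv_dual | apply: rcomp_dual].
by move=> /RCongP[eE cE]; apply/LCongP; split;
  [apply: eqv_dual | apply: lcomp_dual].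
Qed.

(** ** Collapsing the minimal ideal *)

(** The rank 0 element with upper classes the fibres of [k] and with trivial
    lower classes. *)
Definition floor (k : 'I_n -> 'I_n) : PM := partition_of (fun u : points n =>
  match u with inl i => inl (k i) | inr i => inr i end : 'I_n + 'I_n).

Lemma eq_floor k k' : k =1 k' -> floor k = floor k'.
Proof.
by move=> ek; apply: eq_partition_of => -[i|i] [j|j] /=; rewrite ?ek.
Qed.

Lemma transv_floor k i : transv (floor k) i = false.
Proof. by apply/negbTE/negP=> /transvP[j]; rewrite /thru linked_of. Qed.

Lemma prank_transv0 x : (forall i, transv x i = false) -> prank (upat x) = 0.
Proof.
move=> tx; apply/eqP; rewrite cards_eq0; apply/eqP/setP=> A; rewrite inE.
by apply/imsetP=> -[i]; rewrite inE tx.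
Qed.

Lemma transv_prank0 x i : prank (upat x) = 0 -> transv x i = false.
Proof. by move=> x0; rewrite -mem_upat2 (cards0_eq x0) inE. Qed.

Lemma prank_floor k : prank (upat (floor k)) = 0.
Proof. by apply: prank_transv0 => i; rewrite transv_floor. Qed.

Lemma up_floor k x i j : up (floor k ** x) i j = (k i == k j).
Proof.
have [-> _] := proj1 (upatP _ _) (rank0_mulr x (prank_floor k)).
by rewrite /up linked_of.
Qed.

Lemma prank0_mulr x y : prank (upat x) = 0 -> prank (upat (x ** y)) = 0.
Proof. by move=> x0; apply/eqP; rewrite -leqn0 -x0 prank_mul_le. Qed.

Lemma prank0_mull x y : prank (upat y) = 0 -> prank (upat (x ** y)) = 0.
Proof. by move=> y0; apply/eqP; rewrite -leqn0 -y0 prank_mul_ler. Qed.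

Lemma floor_ext k x z : prank (upat x) = 0 -> prank (upat z) = 0 ->
    upat z^~* = upat x^~* -> (forall i j, up z i j = (k i == k j)) ->
  z = floor k ** x.
Proof.
move=> x0 z0 lzx uz; apply: rank0_ext => //; last by rewrite rank0_mull.
apply/upatP; split=> i; first by move=> j; rewrite up_floor.
by rewrite !transv_prank0 // prank0_mull.
Qed.

(** If [x] identifies [i] and [j] while [y] does not, then linking [a] to [i]
    and [b] to [j] merges the classes [a] and [b] in front of [x] only. *)
Lemma merge_step x y i j k a b : prank (upat x) = 0 -> prank (upat y) = 0 ->
    upat x^~* = upat y^~* -> up x i j -> ~~ up y i j ->
  exists s, s ** y = floor k ** x /\
    s ** x = floor (fun l => if k l == a then b else k l) ** x.
Proof.
move=> x0 y0 lxy xij yij; have nij : i != j.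
  by apply: contraNneq yij => ->; apply: up_refl.
pose s : PM := partition_of (fun u : points n =>
  match u with
  | inl l => inl (k l)
  | inr l => if l == i then inl a else if l == j then inl b else inr l
  end : 'I_n + 'I_n).
have lsy : upat (s ** y)^~* = upat x^~* by rewrite rank0_mull.
exists s; split; [apply: (floor_ext x0 (prank0_mull s y0) lsy) |
  apply: (floor_ext x0 (prank0_mull s x0) (rank0_mull s x0))] => l m;
    apply/idP/eqP.
- move=> lm; have [h [yh hi hj]] : exists h,
      [/\ flat y (colour h (fun=> false)), h i = (k l == a) & h j = (k l == b)].
    exists (fun c => if up y i c then k l == a else k l == b).
    split; [|by rewrite up_refl|by rewrite (negbTE yij)].
    apply/flat_colourP; split=> // c d.
      by move=> cd; rewrite (linked_right _ cd : up y i c = up y i d).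
    move=> cd; have : transv y c by apply/transvP; exists d.
    by rewrite transv_prank0.
  pose f c := k l == k c.
  have /= := linked_mulE lm _ yh (f := f);
    rewrite /f eqxx => /(_ _)/esym/eqP-> //.
  apply/flat_of=> -[c|c] [d|d] /=.
  + by case=> ->.
  + case: (d =P i) => [-> [->] | _]; first by rewrite hi.
    by case: (d =P j) => [-> [->] | //]; rewrite hj.
  + case: (c =P i) => [-> [<-] | _]; first by rewrite hi.
    by case: (c =P j) => [-> [<-] | //]; rewrite hj.
  case: (c =P i) => [->|_]; [|case: (c =P j) => [->|_]];
    (case: (d =P i) => [->|_]; [|case: (d =P j) => [->|_]]) => // -[] e.
  + by rewrite hi hj e.
  + by rewrite hi hj e.
  by rewrite e.
- by move=> klm; apply: linked_mulI => f h g /flat_of/(_ (inl l) (inl m)) /=;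
    rewrite klm => ->.
- move=> lm.
  pose kk c := if k c == a then b else k c.
  have /= := linked_mulE lm _ (@flat_cst _ x (kk l == b)) (f := fun c =>
    kk l == kk c).
  rewrite -/(kk l) eqxx => /(_ _)/esym/eqP-> //.
  apply/flat_of=> -[c|c] [d|d] /=.
  + by rewrite /kk => -[->].
  + rewrite /kk; case: eqP => [_ [->] | _]; first by rewrite eqxx.
    case: eqP => [_ [->] | //].
    by case: (b == a).
  + rewrite /kk; case: eqP => [_ [<-] | _]; first by rewrite eqxx.
    case: eqP => [_ [<-] | //].
    by case: (b == a).
  by [].
move=> klm; apply: linked_mulI => f h g /flat_of sf /flat_colourP[xh _ _] /=.
have fa c : k c = a -> f c = h i.
  by move=> kc; apply: (sf (inl c) (inr i)); rewrite /= eqxx kc.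
have fb c : k c = b -> f c = h i.
  move=> kc; rewrite (xh i j xij); apply: (sf (inl c) (inr j)).
  by rewrite /= (eq_sym j) (negbTE nij) eqxx kc.
have fk c d : k c = k d -> f c = f d.
  by move=> kcd; apply: (sf (inl c) (inl d)); rewrite /= kcd.
move: klm; case: eqP => [la|_]; case: eqP => [ma|_] => e.
- by apply: fk; rewrite la ma.
- by rewrite fa // fb.
- by rewrite fb // fa.
exact: fk.
Qed.

(** Merging classes one at a time relates every element of rank 0 with the given
    lower pattern to the one with a single upper class. *)
Lemma left_row_simple E x y z w : eqv E -> lcomp E -> (x, y) \in E ->
    prank (upat x) = 0 -> upat x^~* = upat y^~* -> upat x <> upat y ->
    prank (upat z) = 0 -> prank (upat w) = 0 ->
    upat z^~* = upat x^~* -> upat w^~* = upat x^~* ->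
  (z, w) \in E.
Proof.
move=> [rE sE tE] cE.
wlog [i [j [xij yij]]] : x y / exists i, exists j, up x i j /\ ~~ up y i j.
  move=> IH xy x0 lxy nxy; have y0 : prank (upat y) = 0.
    by rewrite -prank_star -lxy prank_star.
  have [i [j ij]] : exists i, exists j, up x i j <> up y i j.
    case: (boolP [exists i, exists j, up x i j != up y i j]).
      by case/existsP=> i /existsP[j /eqP]; exists i, j.
    move/existsPn=> H; case: nxy; apply/upatP; split=> i.
      by move=> j; have /existsPn/(_ j) := H i; rewrite negbK => /eqP.
    by rewrite !transv_prank0.
  case xij: (up x i j) ij; case yij: (up y i j) => // _.
    by apply: IH xy x0 lxy nxy; exists i, j; rewrite xij yij.
  rewrite lxy; apply: IH (sE _ _ xy) y0 (esym lxy) (nesym nxy).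
  by exists i, j; rewrite xij yij.
move=> xy x0 lxy _ z0 w0 lz lw.
have y0 : prank (upat y) = 0 by rewrite -prank_star -lxy prank_star.
have merge (k : 'I_n -> 'I_n) (l : seq 'I_n) :
    (floor k ** x, floor (fun c => if k c \in l then i else k c) ** x) \in E.
  elim: l => [|a l IHl]; first exact: rE.
  apply: tE IHl _; pose k' c := if k c \in l then i else k c.
  have [s [sy sx]] := merge_step k' a i x0 y0 lxy xij yij.
  suff -> : floor (fun c => if k c \in a :: l then i else k c) =
            floor (fun c => if k' c == a then i else k' c).
    by rewrite -sx -sy; apply/sE/cE.
  apply: eq_floor => c; rewrite /k' in_cons.
  by case: (k c \in l); rewrite ?orbT ?orbF //; case: ifP.
have to_cst z1 : prank (upat z1) = 0 -> upat z1^~* = upat x^~* ->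
    (z1, floor (fun=> i) ** x) \in E.
  move=> z10 lz1; pose k c := odflt c [pick d in cls z1 c].
  have kP c : up z1 c (k c).
    by rewrite /k; case: pickP => [d|_] /=; rewrite ?inE ?up_refl.
  have -> : z1 = floor k ** x.
    apply: floor_ext => // c d; apply/idP/eqP=> [cd|kcd].
      have /eqP e : cls z1 c == cls z1 d by rewrite cls_eq.
      by rewrite /k e; case: pickP => // /(_ d); rewrite cls_refl.
    apply: linked_trans (kP c) _; rewrite kcd linked_sym; exact: kP.
  have <- : floor (fun c => if k c \in enum 'I_n then i else k c) =
    floor (fun=> i).
    by apply: eq_floor => c; rewrite mem_enum.
  exact: merge.
by apply: tE (to_cst z z0 lz) _; apply/sE/to_cst.
Qed.

Lemma right_row_simple E x y z w : eqv E -> rcomp E -> (x, y) \in E ->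
    prank (upat x) = 0 -> upat x = upat y -> upat x^~* <> upat y^~* ->
    upat z = upat x -> upat w = upat x ->
  (z, w) \in E.
Proof.
move=> eE cE xy x0 uxy lxy uz uw; rewrite -[z]starK -[w]starK -dualE.
apply: (@left_row_simple _ x^~* y^~*);
  rewrite ?dualE ?starK ?prank_star ?uz ?uw //.
  exact: eqv_dual.
exact: lcomp_dual.
Qed.

End Congruences.


(** * Right congruences: the upper bound *)

Definition SubG_below (gT : finGroupType) (K : {set gT}) : {set {set gT}} :=
  [set A in SubG [set: gT]%G | A \subset K].

Lemma SubG_P (gT : finGroupType) (A : {set gT}) :
  reflect (exists H : {group gT}, A = H) (A \in SubG [set: gT]%G).
Proof.
apply: (iffP imsetP) => [[H _ ->] | [H ->]]; first by exists H.
by exists H; rewrite // inE subsetT.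
Qed.

Lemma Ht_SubG_gt0 (gT : finGroupType) : 0 < Ht (SubG [set: gT]%G).
Proof. by apply: (@Ht_gt0 _ _ _ (1%g : {set gT})); apply/SubG_P;
  exists 1%G. Qed.

Lemma Ht_SubG_below (gT : finGroupType) (K : {set gT}) :
  Ht (SubG_below K) <= Ht (SubG [set: gT]%G).
Proof. by apply: Ht_sub; apply/subsetP=> A; rewrite inE => /andP[]. Qed.

Lemma Ht_SubG_below_gt0 (gT : finGroupType) (K : {group gT}) :
  0 < Ht (SubG_below K).
Proof.
by apply: (@Ht_gt0 _ _ _ (K : {set gT})); rewrite inE subxx andbT;
  apply/SubG_P; exists K.
Qed.

Lemma Ht_SubG_below_mono (gT : finGroupType) (K L : {set gT}) : K \subset L ->
  Ht (SubG_below K) <= Ht (SubG_below L).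
Proof.
move=> KL; apply: Ht_sub; apply/subsetP=> A; rewrite !inE => /andP[-> AK] /=.
exact: subset_trans AK KL.
Qed.

Lemma Ht_SubG_below_lt (gT : finGroupType) (K L : {group gT}) :
  K \proper L -> Ht (SubG_below K) < Ht (SubG_below L).
Proof.
move=> KL; have := @Ht_below_lt _ _ (SubG [set: gT]%G) (K : {set gT}) (L :
  {set gT}).
rewrite /SubG_below; apply; [by apply/SubG_P; exists K | by apply/SubG_P;
  exists L |].
by rewrite ltEproper.
Qed.

Lemma invariant_split (z a a' c c' : bool) (h h' : nat) :
    (a -> a') -> (c -> c') -> 0 < h -> h <= h' ->
    a' + (z && c') + h'.-1 <= a + (z && c) + h.-1 ->
  [/\ a' -> a, z -> c' -> c & h' <= h].
Proof.
by case: z a a' c c' => -[] [] [] [] /=; (try move/(_ isT)) => // _;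
  (try move/(_ isT)) => // _ h0 hh' le; split=> //; lia.
Qed.

Section RightCongruences.
Variable n : nat.
Local Notation PM := (partition_monoid n).
Local Notation pat := ({set {set 'I_n}} * {set {set 'I_n}})%type.
Local Notation rank x := (prank (upat x)).
Implicit Types (x y z w s t : PM) (d e : pat) (E F : {set PM * PM}).

(** ** A linear order on patterns refining the rank *)

Definition key d : nat := prank d * #|{: pat}| + enum_rank d.

Lemma key_inj : injective key.
Proof.
move=> d e /(congr1 (modn^~ #|{: pat}|)); rewrite /key !modnMDl !modn_small //.
by move/ord_inj/enum_rank_inj.
Qed.

Lemma key_prank d e : prank d < prank e -> key d < key e.
Proof.
move=> de; apply: leq_trans (leq_addr _ _).
apply: (@leq_trans ((prank d).+1 * #|{: pat}|));
  last by rewrite leq_mul2r de orbT.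
by rewrite /key mulSn addnC ltn_add2r.
Qed.

Lemma prank_key d e : key d <= key e -> prank d <= prank e.
Proof. by rewrite leqNgt (leqNgt (prank d)); apply: contra;
  apply: key_prank. Qed.

Lemma key_mul x y : key (upat (x ** y)) <= key (upat x).
Proof.
have [/upat_mul->//|/key_prank/ltnW//] := leqP (rank x) (rank (x ** y)).
Qed.

(** ** Multiplication within an R-class *)

Lemma star_cancel_id x : x ** x^~* ** x = x.
Proof. by rewrite -mulA star_cancel. Qed.

Lemma star_cancel_l x y : upat x^~* = upat y^~* -> y ** x^~* ** x = y.
Proof.
move=> lxy; apply: (can_inj (@starK n)); rewrite !starM starK.
by have := star_cancel lxy; rewrite starK.
Qed.

(** An idempotent of a group is its identity. *)
Lemma mul_star_theta x : x ** x^~* = theta (upat x) 1%g.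
Proof.
have uu : upat (x ** x^~*) = upat x by apply: upat_comp.
have lu : upat (x ** x^~*)^~* = upat x by rewrite starM starK.
have [p ep] := theta_onto (pattern_upat x) uu lu.
rewrite ep; congr theta; apply: (mulgI p); rewrite mulg1.
apply: (theta_inj (pattern_upat x)); rewrite -thetaM ?pattern_upat //.
by rewrite -ep -mulA star_cancel.
Qed.

Lemma mul_star_onto x y d : upat x = d -> upat y = d -> upat x^~* = upat y^~* ->
  exists p, y ** x^~* = theta d p.
Proof.
move=> <- uy lxy; apply: theta_onto; first exact: pattern_upat.
  by rewrite upat_comp.
by rewrite upat_comp_star ?starK.
Qed.

Lemma separation_r x y : rank x = rank y -> 0 < rank x ->
    upat x^~* <> upat y^~* ->
  exists s, upat (x ** s) = upat x /\ rank (y ** s) < rank x \/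
            upat (y ** s) = upat y /\ rank (x ** s) < rank x.
Proof.
move=> rxy r0 lxy.
have [||s [[]|[]]] := @separation n x^~* y^~* _ _ lxy; rewrite ?prank_star //.
  move=> h1 h2; exists s^~*; left; split.
    by apply: upat_mul; rewrite -h1 -prank_star starM starK.
  by rewrite -prank_star starM starK rxy.
move=> h1 h2; exists s^~*; right; split.
  by apply: upat_mul; rewrite -h1 -prank_star starM starK.
by rewrite -prank_star starM starK.
Qed.

(** ** The invariants of a right congruence *)

Definition stab d E : {set {perm 'I_#|d.2|}} := [set p | (theta d 1%g,
  theta d p) \in E].

Definition absorbed d E : bool :=
  [exists x, exists y, [&& (x, y) \in E, upat x == d & key (upat y) < key d]].

Definition collapsed d E : bool :=
  [forall x, forall y, (upat x == d) ==> (upat y == d) ==> ((x, y) \in E)].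

Lemma stab_group d E : pattern d -> eqv E -> rcomp E -> group_set (stab d E).
Proof.
move=> pd [rE sE tE] cE; apply/group_setP; split=> [|p q];
  rewrite !inE // => Ep Eq.
by apply: tE Eq _; have := cE (theta d q) _ _ Ep; rewrite !thetaM // mul1g.
Qed.

Lemma absorbedP d E : reflect
  (exists x y, [/\ (x, y) \in E,
    upat x = d & key (upat y) < key d]) (absorbed d E).
Proof.
apply: (iffP existsP) => [[x /existsP[y /and3P[xy /eqP ux ky]]] |
  [x [y [xy ux ky]]]].
  by exists x, y.
by exists x; apply/existsP; exists y; rewrite xy ux ky eqxx.
Qed.

Lemma absorbed_all d E x : eqv E -> rcomp E -> absorbed d E -> upat x = d ->
  exists2 z, (x, z) \in E & key (upat z) < key d.
Proof.
move=> eE cE /absorbedP[x0 [y0 [xy0 ux0 ky0]]] ux.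
exists (y0 ** (x0^~* ** x)); last exact: leq_ltn_trans (key_mul _ _) ky0.
have := cE (x0^~* ** x) _ _ xy0; by rewrite star_cancel // ux0 ux.
Qed.

(** None of the summands decreases when [E] grows, and together they detect any
    growth at the R-class of [d]. *)
Definition invariant d E : nat :=
  absorbed d E + ((prank d == 0) &&
    collapsed d E) + (Ht (SubG_below (stab d E))).-1.

Lemma absorbed_mono d E F : E \subset F -> absorbed d E -> absorbed d F.
Proof.
move=> /subsetP sEF /absorbedP[x [y [xy ux ky]]].
by apply/absorbedP; exists x, y; rewrite sEF.
Qed.

Lemma collapsed_mono d E F : E \subset F -> collapsed d E -> collapsed d F.
Proof.
move=> /subsetP sEF /forallP H; apply/forallP=> x; apply/forallP=> y.
have /forallP/(_ y)/implyP Hxy := H x.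
by apply/implyP=> ux; apply/implyP=> uy; apply/sEF/(implyP (Hxy ux)).
Qed.

Lemma stab_mono d E F : E \subset F -> stab d E \subset stab d F.
Proof. by move=> /subsetP sEF; apply/subsetP=> p; rewrite !inE; apply: sEF. Qed.

Lemma leq_invariant d E F : E \subset F -> invariant d E <= invariant d F.
Proof.
move=> sEF; rewrite /invariant !leq_add //.
- by case: absorbed (@absorbed_mono d _ _ sEF) => // ->.
- by case: eqP => //= _; case: collapsed (@collapsed_mono d _ _ sEF) => // ->.
by rewrite -!subn1 leq_sub2r // Ht_SubG_below_mono ?stab_mono.
Qed.

Lemma invariant_eq d E F : E \subset F -> pattern d -> eqv E -> rcomp E ->
    eqv F -> rcomp F -> invariant d F <= invariant d E ->
  [/\ absorbed d F -> absorbed d E, stab d F \subset stab d E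
    & prank d == 0 -> collapsed d F -> collapsed d E].
Proof.
move=> sEF pd eE cE eF cF le.
pose K := Group (stab_group pd eE cE); pose L := Group (stab_group pd eF cF).
have K0 : 0 < Ht (SubG_below (stab d E)) := Ht_SubG_below_gt0 K.
have hs := stab_mono d sEF; have hm := Ht_SubG_below_mono hs.
have [ha hc hh] := invariant_split (@absorbed_mono d _ _ sEF)
  (@collapsed_mono d _ _ sEF) K0 hm le.
split=> //.
have lt : stab d E \proper stab d F ->
    Ht (SubG_below (stab d E)) < Ht (SubG_below (stab d F)) :=
    @Ht_SubG_below_lt _ K L.
apply/negPn/negP=> nFE; rewrite properE hs in lt.
by have := lt nFE; rewrite ltnNge hh.
Qed.

(** Pairs are pushed down along absorptions until both members lie in one
    R-class that is not absorbed, where separation leaves only the group or, in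
    rank 0, the collapse. *)
Lemma invariants_determine E F : E \subset F -> eqv E -> rcomp E ->
    eqv F -> rcomp F ->
    (forall d, pattern d -> invariant d F <= invariant d E) ->
  F \subset E.
Proof.
move=> sEF eE cE eF cF inv; apply/subsetP=> -[x y].
have [rE sE tE] := eE; have [rF sF tF] := eF.
have [m] := ubnP (key (upat x) + key (upat y)); elim: m x y => // m IHm x y.
wlog le_yx : x y / key (upat y) <= key (upat x).
  move=> IH lem xy; have [le|/ltnW le] := leqP (key (upat y)) (key (upat x)).
    exact: IH.
  by apply/sE/(IH y x le); [rewrite addnC | apply: sF].
rewrite ltnS => lem xy; have pd := pattern_upat x.
have [iA iS iC] := invariant_eq sEF pd eE cE eF cF (inv _ pd).
case: (boolP (absorbed (upat x) E)) => [aE | naE].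
  have [z xz kz] := absorbed_all eE cE aE (erefl _).
  apply: tE (xz) _; apply: IHm.
    by apply: leq_trans lem; rewrite ltn_add2r.
  by apply: tF _ xy; apply/sF/(subsetP sEF).
have naF : ~~ absorbed (upat x) F by apply: contra naE; apply: iA.
have uxy : upat y = upat x.
  apply: key_inj; apply/eqP; rewrite eqn_leq le_yx leqNgt.
  by apply: contra naF => ky; apply/absorbedP; exists x, y.
have [r0|r_gt0] := posnP (rank x).
  have [lxy|/eqP lxy] := eqVneq (upat x^~*) (upat y^~*).
    by rewrite (rank0_ext r0 (esym uxy) lxy); apply: rE.
  have /forallP/(_ x)/forallP/(_ y) : collapsed (upat x) E.
    apply: iC; first by rewrite r0.
    apply/forallP=> z; apply/forallP=> w; apply/implyP=> /eqP uz.
    by apply/implyP=> /eqP uw; apply: right_row_simple xy _ _ lxy _ _ => //.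
  by rewrite uxy eqxx.
have lxy : upat x^~* = upat y^~*.
  apply/eqP/negPn/negP=> /eqP lxy; case/negP: naF; apply/absorbedP.
  have [|s [[us rs]|[us rs]]] := separation_r _ r_gt0 lxy; first by rewrite uxy.
    by exists (x ** s), (y ** s); split; [apply: cF | | apply: key_prank].
  exists (y ** s), (x ** s); split; [by apply/cF/sF | by rewrite us |].
  exact: key_prank.
have [q eq] := mul_star_onto (erefl _) uxy lxy.
have : q \in stab (upat x) F by rewrite inE -eq -mul_star_theta; apply: cF.
move/(subsetP iS); rewrite inE -eq -mul_star_theta => /(cE x).
by rewrite star_cancel_id star_cancel_l.
Qed.

Lemma invariant_max d E : pattern d ->
  invariant d E <= Ht (SubG [set: {perm 'I_#|d.2|}]%G) + (prank d == 0).
Proof.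
move=> pd; rewrite /invariant; have := Ht_SubG_below (stab d E).
have := Ht_SubG_gt0 {perm 'I_#|d.2|}.
move: (Ht (SubG _)) (Ht (SubG_below _)) => a b.
by case: absorbed; case: (_ == _); case: collapsed => /=; lia.
Qed.

Lemma invariant_first d E : pattern d -> (forall e, pattern e ->
  key d <= key e) ->
  invariant d E < Ht (SubG [set: {perm 'I_#|d.2|}]%G) + (prank d == 0).
Proof.
move=> pd dmin; rewrite /invariant; have := Ht_SubG_below (stab d E).
have := Ht_SubG_gt0 {perm 'I_#|d.2|}.
move: (Ht (SubG _)) (Ht (SubG_below _)) => a b.
have /negbTE -> : ~~ absorbed d E.
  by apply/absorbedP=> -[x [y [_ _]]]; rewrite ltnNge dmin ?pattern_upat.
by case: (_ == _); case: collapsed => /=; lia.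
Qed.

(** The R-class of this pattern is never absorbed, which lowers the bound for
    the sum of the invariants by one. *)
Lemma first_pattern : exists d, [/\ pattern d, prank d = 0 &
  forall e, pattern e -> key d <= key e].
Proof.
pose x : PM := floor id; have px := pattern_upat x.
case: (@arg_minnP _ (upat x) (@pattern n) key px) => d pd dmin.
exists d; split=> //; have := prank_key (dmin _ px); rewrite prank_floor.
by rewrite leqn0 => /eqP.
Qed.

Lemma Ht_RCong_le : Ht (RCong (@mul_part n)) <=
  \sum_(d : pat | pattern d) (Ht (SubG [set:
    {perm 'I_#|d.2|}]%G) + (prank d == 0)).
Proof.
have [d0 [pd0 _ dmin]] := first_pattern.
set N := \sum_(d | _) _; have N_gt0 : 0 < N.
  rewrite /N (bigD1 d0) //= -addnA ltn_addr //.
  exact: Ht_SubG_gt0.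
rewrite -(prednK N_gt0).
apply: (@Ht_rank_le _ _ _ (fun E => \sum_(d | pattern d) invariant d E)).
  move=> E F /RCongP[eE cE] /RCongP[eF cF] EF.
  have /proper_sub sEF : E \proper F by rewrite -ltEproper.
  rewrite ltnNge; apply/negP=> le.
  have /subsetP sFE : F \subset E.
    apply: invariants_determine => // d pd.
    have [_ /esym] := @leqif_sum _ (pattern (n:=n)) (fun d =>
      invariant d E == invariant d F)
      (fun d => invariant d E) (fun d => invariant d F)
      (fun d _ => leqif_eq (leq_invariant d sEF)).
    rewrite eqn_leq le andbT.
    have -> : \sum_(d | pattern d) invariant d E <= \sum_(d |
      pattern d) invariant d F.
      by apply: leq_sum => e _; apply: leq_invariant.
    by move/forall_inP/(_ d pd)/eqP->.
  have : E = F by apply/eqP; rewrite eqEsubset sEF; apply/subsetP.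
  by move=> eEF; move: EF; rewrite eEF ltEproper properxx.
move=> E _; rewrite -ltnS (prednK N_gt0) /N (bigD1 d0) //= [ltnRHS](bigD1 d0)
  //=.
rewrite -addSn leq_add ?invariant_first //.
by apply: leq_sum => d /andP[pd _]; apply: invariant_max.
Qed.

End RightCongruences.


(** * Right congruences: a long chain *)

HB.lock Definition coset_label (n : nat) (d :
  {set {set 'I_n}} * {set {set 'I_n}})
    (A : {set {perm 'I_#|d.2|}}) (x : partition_monoid n) :
    option {set {perm 'I_#|d.2|}} :=
  if [pick p | theta d p == x] is Some p then Some (A :* p)%g else None.

Section CosetLabels.
Variable n : nat.
Local Notation PM := (partition_monoid n).
Local Notation pat := ({set {set 'I_n}} * {set {set 'I_n}})%type.
Implicit Types (x y z u v : PM).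
Variable d : pat.
Hypothesis pd : pattern d.
Local Notation perm_d := {perm 'I_#|d.2|}.
Implicit Types (p q : perm_d) (K L : {group perm_d}).

Lemma coset_label_theta (A : {set perm_d}) p :
  coset_label A (theta d p) = Some (A :* p)%g.
Proof.
rewrite coset_label.unlock;
  case: pickP => [q /eqP/(theta_inj pd)-> // | /(_ p)].
by rewrite eqxx.
Qed.

Lemma coset_labelP (A : {set perm_d}) x :
  (exists p, x = theta d p) \/ coset_label A x = None.
Proof.
rewrite coset_label.unlock; case: pickP => [q /eqP<- | _]; last by right.
by left; exists q.
Qed.

Lemma coset_label_none (A : {set perm_d}) x : upat x != d ->
  coset_label A x = None.
Proof.
by case: (coset_labelP A x) => // -[p ->]; rewrite upat_theta // eqxx.
Qed.

Lemma coset_label_coarsen K L u v : K \subset L ->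
  coset_label K u = coset_label K v -> coset_label L u = coset_label L v.
Proof.
move=> sKL.
case: (coset_labelP K u) => [[p ->]|nu];
  case: (coset_labelP K v) => [[q ->]|nv].
- rewrite !coset_label_theta => -[/rcoset_eqP pq]; congr Some.
  by apply/rcoset_eqP; rewrite !mem_rcoset in pq *; apply: (subsetP sKL).
- by rewrite nv coset_label_theta.
- by rewrite nu coset_label_theta.
move=> _; have nope (A B : {set perm_d}) w :
    coset_label A w = None -> coset_label B w = None.
  by rewrite coset_label.unlock /=; case: pickP.
by rewrite (nope _ _ _ nu) (nope _ _ _ nv).
Qed.

Lemma coset_label_mull K k u : k \in K -> theta d 1%g ** u = u ->
  coset_label K (theta d k ** u) = coset_label K u.
Proof.
move=> kK u1; case: (coset_labelP K u) => [[p ->]|nu].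
  by rewrite thetaM // !coset_label_theta rcosetM rcoset_id.
rewrite nu; case: (coset_labelP K (theta d k ** u)) => // -[p ep].
have eu : u = theta d (k^-1 * p)%g.
  by rewrite -thetaM // -ep mulA thetaM // mulVg u1.
by move: nu; rewrite eu coset_label_theta.
Qed.

Lemma theta1_label K k : coset_label K (theta d 1%g) =
  coset_label K (theta d k) ->
  k \in K.
Proof.
by rewrite !coset_label_theta => -[]; rewrite rcoset1 => ->; apply: rcoset_refl.
Qed.

(** The right syntactic congruence of the partition of the group [theta d] into
    cosets of [A], the rest of the monoid forming one more class. *)
Definition right_syn (A : {set perm_d}) : {set PM * PM} :=
  [set p | [forall b, coset_label A (p.1 ** b) == coset_label A (p.2 ** b)]].

Lemma right_synP (A : {set perm_d}) x y : reflect
  (forall b, coset_label A (x ** b) = coset_label A (y ** b)) ((x,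
    y) \in right_syn A).
Proof. by rewrite inE; apply: (iffP forallP) => H b; apply/eqP/H. Qed.

Lemma right_syn_cong (A : {set perm_d}) :
  eqv (right_syn A) /\ rcomp (right_syn A).
Proof.
split; last by move=> a x y /right_synP xy; apply/right_synP=> b;
  rewrite -!mulA.
split=> [x|x y /right_synP xy|x y z /right_synP xy /right_synP yz];
  apply/right_synP => b //; by rewrite xy ?yz.
Qed.

Lemma right_syn_sub K L : K \subset L -> right_syn K \subset right_syn L.
Proof.
move=> sKL; apply/subsetP=> -[x y] /right_synP xy; apply/right_synP=> b.
exact: coset_label_coarsen (xy b).
Qed.

Lemma right_syn_theta K k :
  ((theta d 1%g, theta d k) \in right_syn K) = (k \in K).
Proof.
apply/right_synP/idP=> [/(_ (theta d 1%g)) | kK b].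
  by rewrite !thetaM // !mulg1; apply: theta1_label.
have -> : theta d k ** b = theta d k ** (theta d 1%g ** b).
  by rewrite mulA thetaM // mulg1.
apply/esym/coset_label_mull => //.
by rewrite mulA thetaM // mulg1.
Qed.

End CosetLabels.

Lemma Ht_SubG_perm0 m : m = 0 -> Ht (SubG [set: {perm 'I_m}]%G) = 1.
Proof.
move=> m0; apply/eqP; rewrite eqn_leq Ht_SubG_gt0 andbT.
have [C [/subsetP sC _ <-]] := Ht_attained (SubG [set: {perm 'I_m}]%G).
rewrite -(cards1 (1%g : {set {perm 'I_m}})).
apply/subset_leq_card/subsetP=> A /sC/SubG_P[H ->]; rewrite inE.
apply/eqP/setP=> p; rewrite inE; have -> : p = 1%g.
  by apply/permP=> -[i lt_i]; exfalso; rewrite m0 in lt_i.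
by rewrite group1 eqxx.
Qed.

Section RightChain.
Variable n : nat.
Local Notation PM := (partition_monoid n).
Local Notation pat := ({set {set 'I_n}} * {set {set 'I_n}})%type.
Local Notation rank x := (prank (upat x)).
Local Notation R := (RCong (@mul_part n)).
Implicit Types (x y z w s t : PM) (d e : pat) (E F : {set PM * PM}) (Z W :
  {set pat}).
Local Notation HtS d := (Ht (SubG [set: {perm 'I_#|(d : pat).2|}]%G)).

Definition rows W : {set PM * PM} :=
  [set p | (p.1 == p.2) || (upat p.1 == upat p.2) && (upat p.1 \in W)].

Definition rees Z : {set PM * PM} :=
  [set p | [|| p.1 == p.2, (upat p.1 == upat p.2) && (rank p.1 == 0)
             | (upat p.1 \in Z) && (upat p.2 \in Z)]].

Definition seg m : {set pat} := [set d | pattern d && (key d < m)].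

Lemma rowsE W x y : ((x, y) \in rows W) =
  (x == y) || (upat x == upat y) && (upat x \in W).
Proof. by rewrite inE. Qed.

Lemma reesE Z x y : ((x, y) \in rees Z) =
  [|| x == y, (upat x == upat y) && (rank x == 0) | (upat x \in Z) &&
    (upat y \in Z)].
Proof. by rewrite inE. Qed.

Lemma seg_upat x m : (upat x \in seg m) = (key (upat x) < m).
Proof. by rewrite inE pattern_upat. Qed.

Lemma rows_RCong W : {in W, forall d, prank d = 0} -> rows W \in R.
Proof.
move=> W0; apply/RCongP; split; first split=> [x|x y|x y z];
  rewrite ?rowsE ?eqxx //.
- case/orP=> [/eqP->|/andP[/eqP-> yW]]; first by rewrite eqxx.
  by rewrite yW eqxx orbT.
- case/orP=> [/eqP-> //|/andP[/eqP exy xW]].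
  by case/orP=> [/eqP<-|/andP[/eqP eyz _]];
    rewrite ?exy ?eyz eqxx -?eyz -exy xW orbT.
move=> a x y; rewrite !rowsE => /orP[/eqP->|/andP[/eqP exy xW]];
  first by rewrite eqxx.
by rewrite !rank0_mulr -?exy ?W0 // exy eqxx -exy xW orbT.
Qed.

Lemma rees_RCong m : rees (seg m) \in R.
Proof.
apply/RCongP; split; first split=> [x|x y|x y z]; rewrite ?reesE ?eqxx //.
- case/or3P=> [/eqP->|/andP[/eqP-> ->]|/andP[-> ->]]; rewrite ?eqxx ?orbT //.
- case/or3P=> [/eqP->//|/andP[/eqP exy x0]|/andP[xZ yZ]].
    case/or3P=> [/eqP<-|/andP[/eqP eyz _]|/andP[yZ zZ]].
    + by rewrite exy eqxx -exy x0 orbT.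
    + by rewrite exy eyz eqxx -eyz -exy x0 orbT.
    by rewrite exy yZ zZ !orbT.
  case/or3P=> [/eqP<-|/andP[/eqP eyz _]|/andP[_ zZ]].
  + by rewrite xZ yZ !orbT.
  + by rewrite -eyz xZ yZ !orbT.
  by rewrite xZ zZ !orbT.
move=> a x y; rewrite !reesE => /or3P[/eqP->|/andP[/eqP exy /eqP x0]|].
- by rewrite eqxx.
- by rewrite !rank0_mulr -?exy // eqxx x0 eqxx orbT.
rewrite !seg_upat => /andP[xm ym].
by rewrite !(leq_ltn_trans (key_mul _ _)) ?orbT.
Qed.

(** Already for n = 2 the lower row carries two set partitions. *)
Lemma row_nontrivial d : 2 <= n -> pattern d -> prank d = 0 ->
  exists x y, [/\ upat x = d, upat y = d & x <> y].
Proof.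
case: n d => [|[|m]] // d _ pd d0; pose i0 : 'I_m.+2 := ord0;
  pose i1 : 'I_m.+2 := lift ord0 ord0.
pose r k := proj d ** star (floor (n := m.+2) k).
have ur k : upat (r k) = d by rewrite rank0_mulr upat_proj.
have lr k : upat (star (r k)) = upat (floor (n := m.+2) k).
  by rewrite rank0_mull ?starK // prank_star prank_floor.
exists (r id), (r (fun=> i0)); split=> // e.
have := congr1 (@upat _ \o @star _) e; rewrite /= !lr => /upatP[/(_ i0 i1) + _].
by rewrite /up !linked_of /=.
Qed.

(** Right multiplication maps each row of the minimal ideal into itself, so the
    rows can be collapsed one after the other. *)
Lemma climb_rows : 2 <= n ->
  climb R #|[set d : pat | pattern d & prank d == 0]| (rows set0)
    (rows [set d : pat | pattern d & prank d == 0]).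
Proof.
move=> n2; set W := [set d | _ & _]; pose s := enum W.
have sW i d : d \in take i s -> pattern d /\ prank d = 0.
  by move/mem_take; rewrite mem_enum inE => /andP[-> /eqP].
have := @climb_seq _ _ R (fun i => rows [set d in take i s]) #|W|.
rewrite take0 cardE take_size.
have -> : [set d in [::]] = set0 :> {set pat} by apply/setP=> d; rewrite !inE.
have -> : [set d in s] = W by apply/setP=> d; rewrite inE mem_enum.
apply=> [i _ | i lt_i].
  by apply: rows_RCong => d; rewrite inE => /sW[].
have d0 : pat := (set0, set0).
pose d := nth d0 s i.
have ds : d \in take i.+1 s by rewrite (take_nth d0) // mem_rcons mem_head.
have nds : d \notin take i s.
  have : uniq (take i s ++ drop i s) by rewrite cat_take_drop enum_uniq.
  rewrite cat_uniq => /and3P[_ /hasPn H _]; apply: H.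
  by rewrite (drop_nth d0) // mem_head.
rewrite ltEproper; apply/properP; split.
  apply/subsetP=> -[x y]; rewrite !rowsE !inE => /orP[->//|/andP[-> xi]].
  by rewrite (take_nth d0) // mem_rcons in_cons xi !orbT.
have [pd dz] := sW _ _ ds; have [x [y [ux uy nxy]]] := row_nontrivial n2 pd dz.
exists (x, y); rewrite rowsE ux uy !inE.
  by rewrite eqxx ds orbT.
by rewrite (negbTE nds) andbF orbF; apply/eqP.
Qed.

(** Between the Rees congruence of an initial right ideal and the next one fit
    the syntactic congruences of a longest chain of subgroups. *)
Lemma climb_rees d0 d : pattern d0 -> prank d0 = 0 -> pattern d ->
  key d0 < key d ->
  climb R (HtS d) (rees (seg (key d))) (rees (seg (key d).+1)).
Proof.
move=> pd0 r0 pd lt_d; set E := rees (seg (key d));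
  set E' := rees (seg (key d).+1).
have sEE' : E \subset E'.
  apply/subsetP=> -[x y]; rewrite !reesE !seg_upat.
  by case/or3P=> [->|->|/andP[xm ym]]; rewrite ?orbT // !ltnS
    (ltnW xm) (ltnW ym) !orbT.
have dE' x : upat x = d -> (x, proj d0) \in E'.
  by move=> ux; rewrite reesE !seg_upat ux upat_proj // !ltnS leqnn (ltnW
    lt_d) !orbT.
have [rd|rd] := posnP (prank d).
  rewrite (Ht_SubG_perm0 rd).
  apply: climb_lt; rewrite ?rees_RCong // ltEproper; apply/properP; split=> //.
  exists (proj d, proj d0); first by rewrite dE' ?upat_proj.
  rewrite reesE !seg_upat !upat_proj // ltnn orbF; apply/norP; split.
    by apply: contraTneq lt_d => /(congr1 (@upat n));
      rewrite !upat_proj // => ->; rewrite ltnn.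
  by apply: contraTN lt_d => /andP[/eqP-> _]; rewrite ltnn.
have [C [/subsetP sC cC <-]] := Ht_attained (SubG [set: {perm 'I_#|d.2|}]%G).
pose f (A : {set {perm 'I_#|d.2|}}) := right_syn A :&: E'.
have EE'R : E' \in R by apply: rees_RCong.
have fR A : f A \in R.
  have [[rA sA tA] cA] := right_syn_cong A;
    have [[rE sE tE] cE] := RCongP _ EE'R.
  apply/RCongP; split; first split=> [x|x y|x y z].
  - by rewrite in_setI rA rE.
  - by rewrite !in_setI => /andP[/sA-> /sE->].
  - by rewrite !in_setI => /andP[xA xE] /andP[yA yE];
      rewrite (tA _ _ _ xA yA) (tE _ _ _ xE yE).
  by move=> a x y; rewrite !in_setI => /andP[/cA-> /cE->].
have Ef A : A \in C -> E \subset f A.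
  move=> AC; rewrite subsetI sEE' andbT; apply/subsetP=> -[x y];
    rewrite reesE => xy.
  apply/right_synP=> b.
  have none z : prank (upat z) = 0 \/ key (upat z) < key d ->
    upat (z ** b) != d.
    case=> [z0 | zd]; apply: contraTneq isT => ezd.
      by move: rd; rewrite -ezd rank0_mulr // z0.
    by have := leq_ltn_trans (key_mul z b) zd; rewrite ezd ltnn.
  case/or3P: xy => [/eqP->//|/andP[/eqP exy /eqP x0]|/andP[]];
    rewrite ?seg_upat.
    by rewrite !coset_label_none ?none //; left; rewrite -?exy.
  by move=> xd yd; rewrite !coset_label_none ?none //; right.
have fC A : A \in C -> exists H : {group {perm 'I_#|d.2|}}, A = H.
  by move/sC/SubG_P.
have fmem A k : A \in C -> ((theta d 1%g, theta d k) \in f A) = (k \in A).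
  move=> /fC[H ->]; rewrite in_setI right_syn_theta //.
  by rewrite reesE !seg_upat !upat_theta // ltnSn /= !orbT andbT.
have fmon A B : A \in C -> B \in C -> A \subset B -> f A \subset f B.
  by move=> /fC[H ->] /fC[L ->] HL; apply/setSI/right_syn_sub.
have E'f A : A \in C -> f A != E'.
  move=> AC; apply/eqP=> e; have : (theta d 1%g, proj d0) \in f A.
    by rewrite e dE' ?upat_theta.
  rewrite in_setI => /andP[/right_synP/(_ (theta d 1%g)) + _].
  rewrite thetaM // coset_label_theta // coset_label_none //.
  rewrite rank0_mulr ?upat_proj //.
  by apply: contraTneq lt_d => ->; rewrite ltnn.
apply: (@climb_image _ _ _ _ f) => //.
  by move=> A AC; rewrite properEneq E'f // subsetIr Ef // fR.
by move=> A B AC BC eAB; apply/setP=> k; rewrite -!fmem // eAB.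
Qed.

Lemma Ht_RCong_ge : 2 <= n ->
  \sum_(d : pat | pattern d) (HtS d + (prank d == 0)) <= Ht R.
Proof.
move=> n2; have [d0 [pd0 r0 dmin]] := first_pattern n.
(* The first R-class is left out: absorbing it into nothing is its collapse,
   which is already a step of the chain of collapses. *)
have main j : climb R (\sum_(d :
  pat | pattern d && (key d0 < key d <= key d0 + j)) HtS d)
    (rees (seg (key d0).+1)) (rees (seg (key d0 + j).+1)).
  elim: j => [|j IHj].
    rewrite addn0 big_pred0 => [|d]; last by rewrite ltnNge; case: leq;
      rewrite ?andbF.
    exact/climb_refl/rees_RCong.
  have [/existsP[d /andP[pd /eqP kd]]|/existsPn nod] :=
    boolP [exists d : pat, pattern d && (key d == key d0 + j.+1)].
    have lt_d : key d0 < key d by rewrite kd addnS ltnS leq_addr.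
    rewrite (bigD1 d) /=; last by rewrite pd lt_d kd leqnn.
    rewrite addnC -kd; apply: climb_trans (climb_rees pd0 r0 pd lt_d).
    rewrite kd addnS (eq_bigl (fun d =>
      pattern d && (key d0 < key d <= key d0 + j))) //.
    move=> e /=; rewrite -andbA -(inj_eq (@key_inj n)) kd; congr (_ && _).
    by move: (key d0) (key e) => a b; lia.
  have nod' e : pattern e -> (key e <= key d0 + j.+1) = (key e <= key d0 + j).
    move=> pe; rewrite leq_eqVlt addnS ltnS.
    by have := nod e; rewrite pe addnS /= => /negbTE->.
  have -> : seg (key d0 + j.+1).+1 = seg (key d0 + j).+1.
    by apply/setP=> e; rewrite !inE !ltnS; case pe: (pattern e);
      rewrite //= nod'.
  rewrite (eq_bigl (fun d => pattern d && (key d0 < key d <= key d0 + j))) //.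
  by move=> e /=; case pe: (pattern e); rewrite //= nod'.
pose J := \max_(d : pat) key d.
have leJ d : key d <= key d0 + J.
  by apply: leq_trans (leq_addl _ _); exact: (@leq_bigmax _ (@key n) d).
have rows_rees : (rows [set d :
  pat | pattern d & prank d == 0] <= rees (seg (key d0).+1))%O.
  rewrite Order.SetSubsetOrder.leEsubset; apply/subsetP=> -[x y];
    rewrite rowsE reesE.
  by case/orP=> [->//|/andP[-> /[!inE]/andP[_ ->]]]; rewrite orbT.
have := climb_lt_Ht (climb_trans (climb_rows n2) (climb_le rows_rees (main J))).
apply: leq_trans; rewrite big_split /= (bigD1 d0) //=.
rewrite (Ht_SubG_perm0 r0).
rewrite (eq_bigl (fun d => pattern d && (key d0 < key d <= key d0 + J)));
  last first.
  move=> d /=; case pd: (pattern d) => //=;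
    rewrite leJ andbT ltn_neqAle dmin // andbT.
  by rewrite (inj_eq (@key_inj n)) eq_sym.
have -> : \sum_(d : pat | pattern d) (prank d == 0) = #|[set d :
  pat | pattern d & prank d == 0]|.
  by rewrite -sum1_card big_mkcond [RHS]big_mkcond; apply: eq_bigr => d _;
    rewrite inE; case: pattern; case: eqP.
by rewrite add1n addSn ltnS addnC.
Qed.

End RightChain.


(** * Counting patterns *)

Section Counting.
Variable n : nat.
Local Notation pat := ({set {set 'I_n}} * {set {set 'I_n}})%type.
Implicit Types (P A : {set {set 'I_n}}).

Lemma card_partition_le P : partition P [set: 'I_n] -> #|P| <= n.
Proof.
move=> pP; rewrite -[leqRHS](card_ord n) -cardsT (card_partition pP) -sum1_card.
apply: leq_sum => A AP; rewrite card_gt0.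
by case/and3P: pP => _ _; apply: contraNneq => <-.
Qed.

Lemma sum_pattern (h : nat -> nat) :
  \sum_(d : pat | pattern d) h (prank d) =
    \sum_(P | partition P [set: 'I_n]) \sum_(A :
      {set {set 'I_n}} | A \subset P) h #|A|.
Proof. by rewrite pair_big_dep. Qed.

(** A pattern is a set partition with k classes together with a choice of r of
    them. *)
Lemma sum_pattern_stirling (h : nat -> nat) :
  \sum_(d : pat | pattern d) h (prank d) =
    \sum_(0 <= r < n.+1) \sum_(r <= k < n.+1) stirling2 n k * 'C(k, r) * h r.
Proof.
rewrite sum_pattern.
have inner P : partition P [set: 'I_n] ->
    \sum_(A : {set {set 'I_n}} | A \subset P) h #|A| =
    \sum_(r < n.+1) 'C(#|P|, r) * h r.
  move=> pP; have leP := card_partition_le pP.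
  rewrite (partition_big (fun A : {set {set 'I_n}} =>
    inord #|A| : 'I_n.+1) xpredT) //=.
  apply: eq_bigr => r _; rewrite -cards_draws -sum_nat_const big_mkcond
    [RHS]big_mkcond.
  apply: eq_bigr => A _; rewrite inE /=; case sAP: (A \subset P) => //=.
  have leA : #|A| < n.+1 by rewrite ltnS (leq_trans (subset_leq_card sAP)).
  by rewrite -(inj_eq val_inj) /= inordK //; case: eqP => // ->.
rewrite (eq_bigr _ inner) exchange_big big_mkord; apply: eq_bigr => r _.
rewrite -big_distrl -big_distrl /=; congr (_ * _).
rewrite (partition_big (fun P => inord #|P| : 'I_n.+1) xpredT) //=.
rewrite (big_nat_widenl _ 0) // big_mkord big_mkcond [RHS]big_mkcond /=.
apply: eq_bigr => k _.
have -> : \sum_(P | partition P [set: 'I_n] && (inord #|P| == k)) 'C(#|P|, r) =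
          stirling2 n k * 'C(k, r).
  rewrite /stirling2 -sum_nat_const big_mkcond [RHS]big_mkcond.
  apply: eq_bigr => P _; rewrite inE; case pP: (partition _ _) => //=.
  rewrite -(inj_eq val_inj) /= inordK ?ltnS ?card_partition_le //.
  by case: eqP => // ->.
by case: leqP => // lt_kr; rewrite bin_small // muln0.
Qed.

(** A pattern of rank 0 is just a set partition. *)
Lemma sum_pattern_bell : \sum_(d : pat | pattern d) (prank d == 0) = bell n.
Proof.
rewrite (sum_pattern (fun r => r == 0)) /bell -sum1_card.
rewrite [RHS](eq_bigl (fun P => partition P [set: 'I_n])) => [|P];
  last by rewrite inE.
apply: eq_bigr => P _; rewrite (bigD1 set0) ?sub0set //= cards0 eqxx.
by rewrite big1 // => A /andP[_]; rewrite cards_eq0 => /negbTE->.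
Qed.

End Counting.

Lemma Ht_RCong n : 2 <= n -> Ht (RCong (@mul_part n)) =
  bell n + \sum_(0 <= r < n.+1) \sum_(r <= k < n.+1)
             stirling2 n k * 'C(k, r) * Ht (SubG [set: 'S_r]%G).
Proof.
move=> n2; rewrite -sum_pattern_bell -sum_pattern_stirling addnC -big_split.
by apply/eqP; rewrite eqn_leq Ht_RCong_le Ht_RCong_ge.
Qed.


(** * Normal subgroups of symmetric groups *)

Local Notation AltS m := ('Alt_('I_m))%g.

Definition NSub (gT : finGroupType) : {set {set gT}} :=
  [set A in SubG [set: gT]%G | [set: gT] \subset 'N(A)%g].

Lemma NSubP (gT : finGroupType) (A : {set gT}) : reflect
  (exists H : {group gT}, A = H /\ [set: gT] \subset 'N(H)%g) (A \in NSub gT).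
Proof.
rewrite inE; apply: (iffP andP) => [[/SubG_P[H ->] nH] | [H [-> nH]]].
  by exists H.
by split=> //; apply/SubG_P; exists H.
Qed.

Lemma NSub_group (gT : finGroupType) (H : {group gT}) :
  [set: gT] \subset 'N(H)%g -> (H : {set gT}) \in NSub gT.
Proof. by move=> nH; apply/NSubP; exists H. Qed.

(** Conjugates of an element moving [x] carry [x] to any other point, so a
    nontrivial normal subgroup is transitive. *)
Lemma normal_Sym_card m (N : {group 'S_m}) : [set: 'S_m] \subset 'N(N)%g ->
  N :!=: 1%g -> m <= #|N|.
Proof.
move=> nN /trivgPn[g gN g1].
have [x gx] : exists x, g x != x.
  apply/existsP; apply: contraR g1 => /existsPn H; apply/eqP/permP=> x.
  by have := H x; rewrite negbK perm1 => /eqP.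
rewrite -{1}(card_ord m) -cardsT;
  apply: leq_trans (leq_imset_card (fun s : 'S_m => s x) N).
apply/subset_leq_card/subsetP=> z _; have [->|zx] := eqVneq z x.
  by apply/imsetP; exists 1%g; rewrite ?perm1.
apply/imsetP; exists (g ^ tperm (g x) z)%g.
  by rewrite memJ_norm // (subsetP nN) ?inE.
by rewrite -{2}(@tpermD _ (g x) z x) ?permJ ?tpermL // eq_sym.
Qed.

Lemma NSub_card_lt (gT : finGroupType) (A B : {set gT}) : A \in NSub gT ->
  B \in NSub gT -> (A < B)%O -> [/\ #|A| %| #|B|, #|B| %| #|gT| & #|A| < #|B|].
Proof.
move=> /NSubP[H [-> _]] /NSubP[K [-> _]]; rewrite ltEproper => HK.
by rewrite cardSg ?proper_sub // -[#|gT|]cardsT cardSg ?subsetT // proper_card.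
Qed.

(** When the orders of the normal subgroups are suitably ranked, divisibility
    bounds the length of a chain. *)
Lemma Ht_NSub_card_le (gT : finGroupType) (f : nat -> nat) N k :
    {in NSub gT, forall A : {set gT}, (#|A| == 1) || (N < #|A|)} ->
    all (fun a => (f a <= k) && all (fun b =>
      [&& a %| b, a < b & (a == 1) || (N < a)] ==> (f a < f b))
      (divisors #|gT|)) (divisors #|gT|) ->
  Ht (NSub gT) <= k.+1.
Proof.
move=> lb /allP chk; have g0 : 0 < #|gT| by rewrite -cardsT cardG_gt0.
have dvd A : A \in NSub gT -> #|A| \in divisors #|gT|.
  by case/NSubP=> H [-> _]; rewrite -dvdn_divisors // -cardsT cardSg ?subsetT.
apply: (@Ht_rank_le _ _ _ (fun A : {set gT} => f #|A|)) => [A B AN BN AB | A].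
  have [ab _ lt] := NSub_card_lt AN BN AB.
  have /andP[_ /allP/(_ _ (dvd B BN))] := chk _ (dvd A AN).
  by rewrite ab lt lb.
by move/dvd/chk/andP=> [].
Qed.

Lemma NSub_perm_card m (A : {set 'S_m}) : A \in NSub 'S_m ->
  (#|A| == 1) || (m.-1 < #|A|).
Proof.
case/NSubP=> H [-> nH]; have [->|H1] := eqVneq (H : {set _}) 1%g.
  by rewrite cards1.
have := normal_Sym_card nH H1; case: m {A} H {nH H1} => [|m] H /= lt.
  by rewrite cardG_gt0 orbT.
by rewrite lt orbT.
Qed.

Lemma Ht_NSub_Sym_small m (f : nat -> nat) k :
    all (fun a => (f a <= k) && all (fun b =>
      [&& a %| b, a < b & (a == 1) || (m.-1 < a)] ==> (f a < f b))
      (divisors m`!)) (divisors m`!) ->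
  Ht (NSub 'S_m) <= k.+1.
Proof.
by rewrite -card_Sn; apply: Ht_NSub_card_le => A; apply: NSub_perm_card.
Qed.

(** Orders increase strictly along proper divisibility. For m = 4 a nontrivial
    normal subgroup has order at least 4, so a chain has one step less than 24
    has prime factors. *)
Lemma Ht_NSub_Sym_le4 m : m <= 4 -> Ht (NSub 'S_m) <= maxn m 1.
Proof.
case: m => [|[|[|[|[|//]]]]] _.
- exact: (@Ht_NSub_Sym_small 0 predn 0).
- exact: (@Ht_NSub_Sym_small 1 predn 0).
- exact: (@Ht_NSub_Sym_small 2 predn 1).
- exact: (@Ht_NSub_Sym_small 3 (fun a => (1 < a) + (3 < a)) 2).
exact: (@Ht_NSub_Sym_small 4 (fun a => (1 < a) + (6 < a) + (12 < a)) 3).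
Qed.

(** For m >= 5 a normal subgroup meets the simple group 'Alt_m in a trivial or
    full subgroup; whether it has odd members is the only other thing that can
    vary, which leaves three levels. *)
Lemma Ht_NSub_Sym_le5 m : 5 <= m -> Ht (NSub 'S_m) <= 3.
Proof.
move=> m5; have /simpleP[_ simA] :
  simple (AltS m) by rewrite simple_Alt5 ?card_ord.
pose f (A : {set 'S_m}) := (A :&: (AltS m) != 1)%g + ~~ (A \subset (AltS m)).
apply: (@Ht_rank_le _ _ _ f) => [A B | A _]; last by rewrite /f;
  do 2!case: (~~ _).
case/NSubP=> H [-> nH] /NSubP[K [-> nK]]; rewrite ltEproper => HK.
have sHK := proper_sub HK.
have meet (L : {group 'S_m}) : [set: 'S_m] \subset 'N(L)%g ->
    (L :&: (AltS m))%g = 1%g \/ (L :&: (AltS m))%g = AltS m.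
  move=> nL; apply: simA; rewrite /normal subsetIr normsI ?normG //.
  exact: subset_trans (subsetT _) nL.
have leA : (H :&: (AltS m) != 1)%g -> (K :&: (AltS m) != 1)%g.
  apply: contraNN => /eqP K1; rewrite -subG1 -K1; exact: setSI.
have leB : ~~ (H \subset (AltS m)) -> ~~ (K \subset (AltS m)).
  by apply: contraNN; apply: subset_trans.
rewrite /f ltnNge; apply: contraL HK => le.
have [eA eB] : (H :&: (AltS m) != 1)%g = (K :&: (AltS m) != 1)%g /\
    (H \subset (AltS m)) = (K \subset (AltS m)).
  move: leA leB le; case: (_ != _); case: (_ != _); case: (_ \subset _);
    case: (_ \subset _) => h1 h2 le;
    first [by [] | by have := h1 isT | by have := h2 isT].
have eHK : (H :&: (AltS m) = K :&: (AltS m))%g.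
  have [eH|eH] := meet H nH; have [eK|eK] := meet K nK; rewrite eH eK //.
    by move: eA; rewrite eH eqxx eK => /esym/negbT; rewrite negbK => /eqP.
  by move: eA; rewrite eK eqxx eH => /negbT; rewrite negbK => /eqP.
rewrite properE sHK negbK /=; apply/subsetP=> h hK.
have even_H p : p \in K -> ~~ odd_perm p -> p \in H.
  move=> pK p0; have : p \in (K :&: AltS m)%g by rewrite inE pK Alt_even.
  by rewrite -eHK inE => /andP[].
case: (boolP (odd_perm h)) => [odd_h|]; last exact: even_H.
have: ~~ (H \subset (AltS m)).
  by rewrite eB; apply/subsetPn; exists h; rewrite ?Alt_even ?odd_h.
case/subsetPn=> g gH; rewrite Alt_even negbK => odd_g.
rewrite -(groupMr _ gH); apply: even_H; last by rewrite odd_permM odd_h odd_g.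
by rewrite groupM // (subsetP sHK).
Qed.

(** ** Chains of normal subgroups *)

Lemma Ht_NSub_ge (gT : finGroupType) (s : seq {set gT}) : uniq s ->
  all (mem (NSub gT)) s -> pairwise (fun A B : {set gT} => A \subset B) s ->
  size s <= Ht (NSub gT).
Proof.
move=> us /allP sN ps; rewrite -(card_uniqP us) -(cardsE (mem s)).
apply: card_chain_Ht; first by apply/subsetP=> A; rewrite inE => /sN.
apply/is_chainP=> A B; rewrite !inE comparable_subset.
elim: s ps {us sN} => //= C s IHs /andP[/allP Cs ps].
rewrite !inE => /orP[/eqP->|As] /orP[/eqP->|Bs]; rewrite ?subxx ?Cs ?orbT //.
exact: IHs.
Qed.

Lemma NSub1 (gT : finGroupType) : (1%g : {set gT}) \in NSub gT.
Proof. by apply/NSubP; exists 1%G; rewrite norms1. Qed.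

Lemma NSubT (gT : finGroupType) : [set: gT] \in NSub gT.
Proof. by apply/NSubP; exists [set: gT]%G; rewrite normG. Qed.

Lemma NSub_Alt m : (AltS m : {set 'S_m}) \in NSub 'S_m.
Proof.
by apply/NSubP; exists ('Alt_('I_m))%G; rewrite normal_norm ?Alt_normal.
Qed.

Lemma Ht_NSub_Sym_ge3 m : 3 <= m -> 3 <= Ht (NSub 'S_m).
Proof.
move=> m3; have cA : 2 * #|AltS m| = m`!.
  by rewrite card_Alt card_ord // ltnW.
have m6 : 6 <= m`! by rewrite (@leq_trans 3`!) // leq_fact.
apply: (@Ht_NSub_ge _ [:: 1%g; (AltS m : {set _}); [set: 'S_m]]).
- rewrite /= !inE !negb_or; apply/and3P; split=> //; last first.
    by apply/eqP=> /(congr1 (fun A : {set _} => #|A|));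
      rewrite cardsT card_Sn -cA; move: cA m6; lia.
  apply/andP; split; apply/eqP=> /(congr1 (fun A : {set _} => #|A|)).
    by rewrite cards1; move: cA m6; lia.
  by rewrite cards1 cardsT card_Sn; move: m6; lia.
- by rewrite /= NSub1 NSub_Alt NSubT.
by rewrite /= !subsetT sub1G.
Qed.

(** ** The Klein four-group *)

Section Klein.
Implicit Types (s t : 'S_4) (x y z : 'I_4).

Lemma four_points x y z (a b : 'I_4) : x != y -> x != z -> y != z ->
    a != x -> a != y -> a != z -> b != x -> b != y -> b != z ->
  a = b.
Proof.
move=> xy xz yz ax ay az bx b_y bz; apply: val_inj => /=.
move: (ltn_ord x) (ltn_ord y) (ltn_ord z) (ltn_ord a) (ltn_ord b).
move: xy xz yz ax ay az bx b_y bz; rewrite -!(inj_eq val_inj) /=.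
by move: (val x) (val y) (val z) (val a) (val b) => p q r c d; lia.
Qed.

(** The products of two disjoint transpositions are the fixed-point-free
    involutions of four points. *)
Definition double_swap s : bool := [forall x, (s x != x) && (s (s x) == x)].

Lemma double_swapP s :
  reflect (forall x, s x != x /\ s (s x) = x) (double_swap s).
Proof.
apply: (iffP forallP) => H x; first by have /andP[? /eqP] := H x.
by have [-> ->] := H x; rewrite eqxx.
Qed.

Definition klein_set : {set 'S_4} := [set s | (s == 1%g) || double_swap s].

(** Two double transpositions that agree at [x] share the pair of [x], and both
    swap the two other points. *)
Lemma klein_determined s t x : s \in klein_set -> t \in klein_set ->
  s x = t x -> s = t.
Proof.
rewrite !inE => /orP[/eqP->|/double_swapP ds] /orP[/eqP->|/double_swapP dt] //.
- by rewrite perm1 => e; have [] := dt x; rewrite -e eqxx.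
- by rewrite perm1 => e; have [] := ds x; rewrite e eqxx.
move=> e; apply/permP=> z.
have [->//|zx] := eqVneq z x; have [->|zs] := eqVneq z (s x).
  by rewrite (ds x).2 e (dt x).2.
have neq u (du : forall x, u x != x /\ u (u x) = x) : u x = s x ->
    [/\ u z != x, u z != s x & u z != z].
  move=> ux; split; last exact: (du z).1.
    by apply: contraNneq zs => uz; rewrite -ux -uz (du z).2.
  by apply: contraNneq zx => /(congr1 u); rewrite (du z).2 -ux (du x).2 => ->.
have [s1 s2 s3] := neq s ds (erefl _); have [t1 t2 t3] := neq t dt (esym e).
by apply: four_points s1 s2 s3 t1 t2 t3; rewrite // eq_sym // (ds x).1.
Qed.

Lemma klein_group_set : group_set klein_set.
Proof.
apply/group_setP; split=> [|s t sV tV]; first by rewrite inE eqxx.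
have [->|nst] := eqVneq s t.
  move: tV; rewrite inE => /orP[/eqP->|/double_swapP dt];
    first by rewrite mulg1 inE eqxx.
  rewrite inE; apply/orP; left; apply/eqP/permP=> x.
  by rewrite permM perm1 (dt x).2.
move: (sV) (tV); rewrite !inE => /orP[/eqP->|/double_swapP ds].
  by rewrite mul1g.
case/orP=> [/eqP->|/double_swapP dt]; first by rewrite mulg1; apply/orP;
  right; apply/double_swapP.
have ne x : s x != t x by apply: contraNneq nst => /(klein_determined sV tV)->.
have ne1 x : t (s x) != x.
  by apply: contraNneq (ne x) => e; rewrite -{2}e (dt _).2.
have ne2 x : s (t x) != x.
  by apply: contraNneq (ne x) => e; rewrite -{1}e (ds _).2.
have comm x : t (s x) = s (t x).
  have [sx _] := ds x; have [tx _] := dt x.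
  apply: (@four_points x (s x) (t x)); rewrite // ?(eq_sym x) //.
  - exact: (dt _).1.
  - by apply: contraNneq sx => /perm_inj->.
  - by apply: contraNneq tx => /perm_inj->.
  exact: (ds _).1.
apply/orP; right; apply/double_swapP=> x; rewrite !permM; split;
  first exact: ne1.
by rewrite comm (dt _).2 (ds _).2.
Qed.

Definition klein : {group 'S_4} := Group klein_group_set.

Lemma klein_normal : [set: 'S_4] \subset 'N(klein)%g.
Proof.
apply/subsetP=> g _; rewrite inE; apply/subsetP=> _ /imsetP[s sV ->].
move: sV; rewrite !inE => /orP[/eqP->|/double_swapP ds];
  first by rewrite conj1g eqxx.
apply/orP; right; apply/double_swapP=> x; rewrite -[x](permKV g) !permJ.
by rewrite (inj_eq perm_inj) (ds _).2 (ds _).1.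
Qed.

Lemma klein_card : #|klein| <= 4.
Proof.
rewrite -(card_in_imset (f := fun s : 'S_4 => s ord0)) => [|s t sV tV].
  by rewrite -[leqRHS](card_ord 4) max_card.
exact: klein_determined.
Qed.

(** The even part of [klein] is normal, nontrivial and of order at most 4; it
    fits strictly between 1 and the alternating group. *)
Lemma klein_even : (klein :&: AltS 4 != 1)%g.
Proof.
pose i1 : 'I_4 := inord 1; pose i2 : 'I_4 := inord 2.
pose v := (tperm ord0 ord_max * tperm i1 i2)%g : 'S_4.
have vE x : v x = rev_ord x.
  apply: val_inj; rewrite permM /tperm !permE /= -!val_eqE /= !inordK //.
  case: x => -[|[|[|[|//]]]] lx /=; rewrite ?inordK //.
have v0 : v != 1%g.
  by apply/eqP=> /permP/(_ ord0); rewrite vE perm1 => /(congr1 val).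
apply/trivgPn; exists v => //; rewrite inE; apply/andP; split.
  rewrite inE; apply/orP; right; apply/double_swapP=> x; rewrite !vE rev_ordK;
    split=> //.
  rewrite -(inj_eq val_inj) /=; case: x => x /= lx.
  by move: lx; case: x => [|[|[|[|]]]].
rewrite Alt_even odd_permM !odd_tperm.
by rewrite -!(inj_eq val_inj) /= !inordK.
Qed.

Lemma Ht_NSub_Sym4_ge : 4 <= Ht (NSub 'S_4).
Proof.
have cA : 2 * #|AltS 4| = 4`! by rewrite card_Alt card_ord.
pose W := (klein :&: AltS 4)%G.
have WN : (W : {set 'S_4}) \in NSub 'S_4.
  apply: NSub_group; apply: normsI; first exact: klein_normal.
  by move: (NSub_Alt 4); rewrite inE => /andP[].
have cW : #|W| <= 4 by apply: leq_trans klein_card;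
  rewrite subset_leq_card ?subsetIl.
apply: (@Ht_NSub_ge _ [:: 1%g; (W : {set _}); (AltS 4 : {set _}); [set: 'S_4]]).
- have W1 : 1 < #|W| by rewrite cardG_gt1 klein_even.
  apply: (@map_uniq _ _ (fun A : {set 'S_4} => #|A|)); rewrite /= !inE !negb_or.
  rewrite cards1 cardsT card_Sn; move: cA W1 cW; have -> : 4`! = 24 by [].
  by move: #|W| #|AltS 4| => a b; lia.
- by rewrite /= NSub1 NSub_Alt NSubT WN.
have sWA : W \subset AltS 4 by apply: subsetIr.
by rewrite /pairwise /all !subsetT !(sub1G W) !sub1G sWA.
Qed.

End Klein.

Lemma Ht_NSub_Sym m : Ht (NSub 'S_m) =
  if m <= 4 then maxn m 1 else 3.
Proof.
case: leqP => m4; apply/eqP; rewrite eqn_leq; last first.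
  by rewrite Ht_NSub_Sym_le5 // Ht_NSub_Sym_ge3 // ltnW // ltnW.
rewrite Ht_NSub_Sym_le4 //=; case: m m4 => [|[|[|[|[|//]]]]] _.
- exact: Ht_gt0 (NSub1 _).
- exact: Ht_gt0 (NSub1 _).
- apply: (@Ht_NSub_ge _ [:: 1%g; [set: 'S_2]]).
  + rewrite /= inE andbT; apply/eqP=> /(congr1 (fun A : {set _} => #|A|)).
    by rewrite cards1 cardsT card_Sn.
  + by rewrite /= NSub1 NSubT.
  by rewrite /= subsetT.
- exact: Ht_NSub_Sym_ge3.
exact: Ht_NSub_Sym4_ge.
Qed.


(** * Two-sided congruences: the upper bound *)

Definition NSub_below (gT : finGroupType) (K : {set gT}) : {set {set gT}} :=
  [set A in NSub gT | A \subset K].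

Section TwoSided.
Variable n : nat.
Local Notation PM := (partition_monoid n).
Local Notation pat := ({set {set 'I_n}} * {set {set 'I_n}})%type.
Local Notation rank x := (prank (upat x)).
Implicit Types (x y z w s t : PM) (d e : pat) (E F : {set PM * PM}) (r : nat).

(** One pattern of each rank, to fix one maximal subgroup per J-class. *)
Definition std r : pat :=
  ([set [set i] | i : 'I_n], [set [set i] | i : 'I_n & i < r]).

Lemma pattern_std r : pattern (std r).
Proof.
apply/andP; split; last by apply: imsetS; apply/subsetP=> i; rewrite inE.
have -> : (std r).1 = equivalence_partition (fun i j : 'I_n =>
  i == j) [set: 'I_n].
  apply/setP=> A; apply/imsetP/imsetP=> -[i _ ->]; exists i => //;
  by apply/setP=> j; rewrite !inE // eq_sym.
by apply/equivalence_partitionP=> i j k _ _ _; split=> [|/eqP->].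
Qed.

Lemma prank_std r : r <= n -> prank (std r) = r.
Proof.
move=> rn; rewrite /prank card_imset; last exact: set1_inj.
rewrite -sum1_card (eq_bigl (fun i : 'I_n => i < r)); last by move=> i;
  rewrite inE.
rewrite -(big_ord_widen n (fun=> 1)) // sum1_card card_ord //.
Qed.

Lemma rank_le_n x : rank x <= n.
Proof.
apply: leq_trans (card_partition_le (andP (pattern_upat x)).1).
exact: subset_leq_card (andP (pattern_upat x)).2.
Qed.

Definition drops r E : bool :=
  [exists x, exists y, [&& (x, y) \in E, rank x == r & rank y < r]].
Definition joins_upper E : bool :=
  [exists x, exists y, [&& (x, y) \in E, rank x == 0,
    rank y == 0 & upat x != upat y]].
Definition joins_lower E : bool :=
  [exists x, exists y, [&& (x, y) \in E, rank x == 0, rank y == 0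
                         & upat x^~* != upat y^~*]].

Lemma dropsP r E : reflect
  (exists x y, [/\ (x, y) \in E, rank x = r & rank y < r]) (drops r E).
Proof.
apply: (iffP existsP) => [[x /existsP[y /and3P[xy /eqP ? ?]]] |
  [x [y [xy rx ry]]]].
  by exists x, y.
by exists x; apply/existsP; exists y; rewrite xy rx eqxx ry.
Qed.

Lemma joins_upperP E : reflect (exists x y,
  [/\ (x, y) \in E, rank x = 0, rank y = 0 & upat x <> upat y]) (joins_upper E).
Proof.
apply: (iffP existsP) => [[x /existsP[y /and4P[xy /eqP ? /eqP ? /eqP ?]]] |
  [x [y [xy rx ry /eqP ne]]]]; first by exists x, y.
by exists x; apply/existsP; exists y; rewrite xy rx ry ne.
Qed.

Lemma joins_lowerP E : reflect (exists x y,
  [/\ (x, y) \in E, rank x = 0,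
    rank y = 0 & upat x^~* <> upat y^~*]) (joins_lower E).
Proof.
apply: (iffP existsP) => [[x /existsP[y /and4P[xy /eqP ? /eqP ? /eqP ?]]] |
  [x [y [xy rx ry /eqP ne]]]]; first by exists x, y.
by exists x; apply/existsP; exists y; rewrite xy rx ry ne.
Qed.

Lemma drops_mono r E F : E \subset F -> drops r E -> drops r F.
Proof.
by move=> /subsetP sEF /dropsP[x [y [xy ? ?]]]; apply/dropsP; exists x, y;
  rewrite sEF.
Qed.

Lemma joins_upper_mono E F : E \subset F -> joins_upper E -> joins_upper F.
Proof.
move=> /subsetP sEF /joins_upperP[x [y [xy ? ? ?]]]; apply/joins_upperP.
by exists x, y; rewrite sEF.
Qed.

Lemma joins_lower_mono E F : E \subset F -> joins_lower E -> joins_lower F.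
Proof.
move=> /subsetP sEF /joins_lowerP[x [y [xy ? ? ?]]]; apply/joins_lowerP.
by exists x, y; rewrite sEF.
Qed.

(** All elements of one rank are multiples of each other, so one drop drops the
    whole J-class. *)
Lemma drops_all r E x : eqv E -> lcomp E -> rcomp E -> drops r E ->
  rank x = r ->
  exists2 z, (x, z) \in E & rank z < r.
Proof.
move=> eE lE cE /dropsP[x0 [y0 [xy0 rx0 ry0]]] rx.
have [|c [uc lc]] := connector (pattern_upat x) (pattern_upat x0).
  by rewrite rx rx0.
have ux : upat (c ** x0) = upat x by rewrite upat_comp.
pose t := (c ** x0)^~* ** x.
exists (c ** y0 ** t); last first.
  apply: leq_ltn_trans (prank_mul_le _ _) _.
  exact: leq_ltn_trans (prank_mul_ler _ _) _.
by have := cE t _ _ (lE c _ _ xy0); rewrite star_cancel.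
Qed.

Lemma stab_normal d E : pattern d -> eqv E -> lcomp E -> rcomp E ->
  stab d E \in NSub {perm 'I_#|d.2|}.
Proof.
move=> pd eE lE cE; apply/NSubP; exists (Group (stab_group pd eE cE));
  split=> //.
apply/subsetP=> g _; rewrite inE; apply/subsetP=> _ /imsetP[p Ep ->].
move: Ep; rewrite !inE => /(lE (theta d g^-1%g))/(cE (theta d g)).
by rewrite !thetaM // mulg1 mulVg conjgE mulgA.
Qed.

Definition level r E : nat :=
  drops r E + (Ht (NSub_below (stab (std r) E))).-1.

Definition total E : nat :=
  (\sum_(r < n) level r.+1 E) + (joins_upper E + joins_lower E).

(** Related elements of a positive rank that does not drop are H-related, by
    separation on both sides, and can be moved into the chosen maximal subgroup
    of that rank. Related elements of rank 0 are compared through their product,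
    which has the upper pattern of the first and the lower pattern of the
    second. *)
Lemma invariants_determine2 E F : E \subset F ->
    eqv E -> lcomp E -> rcomp E -> eqv F -> lcomp F -> rcomp F ->
    (forall r, 0 < r -> r <= n -> drops r F -> drops r E) ->
    (forall r, 0 < r -> r <= n -> stab (std r) F \subset stab (std r) E) ->
    (joins_upper F -> joins_upper E) -> (joins_lower F -> joins_lower E) ->
  F \subset E.
Proof.
move=> sEF eE lE cE eF lF cF hD hS hU hL; apply/subsetP=> -[x y].
have [rE sE tE] := eE; have [rF sF tF] := eF.
have [m] := ubnP (rank x + rank y); elim: m x y => // m IHm x y.
wlog le_yx : x y / rank y <= rank x.
  move=> IH lem xy; have [le|/ltnW le] := leqP (rank y) (rank x).
    exact: IH.
  by apply/sE/(IH y x le); [rewrite addnC | apply: sF].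
rewrite ltnS => lem xy; have rn := rank_le_n x.
case: (boolP (drops (rank x) E)) => [dE | ndE].
  have [z xz rz] := drops_all eE lE cE dE (erefl _).
  apply: tE (xz) _; apply: IHm.
    by apply: leq_trans lem; rewrite ltn_add2r.
  by apply: tF _ xy; apply/sF/(subsetP sEF).
have [r0|r_gt0] := posnP (rank x).
  have y0 : rank y = 0 by apply/eqP; rewrite -leqn0 -r0.
  have w0 : rank (x ** y) = 0 by rewrite prank0_mulr.
  have uw : upat (x ** y) = upat x by rewrite rank0_mulr.
  have lw : upat (x ** y)^~* = upat y^~* by rewrite rank0_mull.
  apply: tE (_ : (x, x ** y) \in E) _.
    have [lxy|/eqP lxy] := eqVneq (upat x^~*) (upat y^~*).
      by rewrite -(rank0_ext r0 (esym uw)) ?lw.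
    have /hL/joins_lowerP[x1 [y1 [xy1 x10 y10 l1]]] : joins_lower F.
      by apply/joins_lowerP; exists x, y.
    apply: right_row_simple (lE x _ _ xy1) _ _ _ _ _ => //.
    - by rewrite prank0_mulr.
    - by rewrite !rank0_mulr.
    - by rewrite !rank0_mull.
    - by rewrite rank0_mulr.
    by rewrite uw rank0_mulr.
  have [uxy|/eqP uxy] := eqVneq (upat x) (upat y).
    by rewrite (rank0_ext w0 _ lw) // uw.
  have /hU/joins_upperP[x1 [y1 [xy1 x10 y10 u1]]] : joins_upper F.
    by apply/joins_upperP; exists x, y.
  apply: left_row_simple (cE y _ _ xy1) _ _ _ _ _ _ _ => //.
  - by rewrite prank0_mulr.
  - by rewrite !rank0_mull.
  - by rewrite !rank0_mulr.
  - by rewrite lw rank0_mull.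
  by rewrite rank0_mull.
have ndF : ~~ drops (rank x) F by apply: contra ndE; apply: hD.
have rxy : rank x = rank y.
  apply/eqP; rewrite eqn_leq le_yx andbT leqNgt; apply: contra ndF => lt.
  by apply/dropsP; exists x, y.
have lxy : upat x^~* = upat y^~*.
  apply/eqP/negPn/negP=> /eqP lxy; case/negP: ndF; apply/dropsP.
  have [s [[us rs]|[us rs]]] := separation_r rxy r_gt0 lxy.
    by exists (x ** s), (y ** s); split; [apply: cF | rewrite us |].
  by exists (y ** s), (x ** s); split; [apply/cF/sF | rewrite us |].
have uxy : upat x = upat y.
  apply/eqP/negPn/negP=> /eqP uxy; case/negP: ndF; apply/dropsP.
  have [s [[us rs]|[us rs]]] := separation rxy r_gt0 uxy.
    by exists (s ** x), (s ** y); rewrite us; split;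
      [apply: lF | | rewrite rxy].
  by exists (s ** y), (s ** x); rewrite us; split;
    [apply/lF/sF | rewrite rxy |].
have [|c [uc lc]] := connector (pattern_std (rank x)) (pattern_upat x).
  by rewrite prank_std.
have ucx : upat (c ** x) = std (rank x) by rewrite upat_comp.
have ucy : upat (c ** y) = std (rank x) by rewrite upat_comp // -uxy.
have lcxy : upat (c ** x)^~* = upat (c ** y)^~*.
  by rewrite !upat_comp_star // -uxy.
have [q eq] := mul_star_onto ucx ucy lcxy.
have : q \in stab (std (rank x)) F.
  by rewrite inE -eq -ucx -mul_star_theta; apply/cF/lF.
move/(subsetP (hS _ r_gt0 rn));
  rewrite inE -eq -ucx -mul_star_theta => /(cE (c ** x)).
rewrite star_cancel_id star_cancel_l // => /(lE c^~*).
have cK z : upat z = upat x -> c^~* ** (c ** z) = z.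
  by move=> uz; have := @star_cancel n c^~* z; rewrite starK lc uz; apply.
by rewrite !cK.
Qed.

Lemma NSub_below_Ht_le (gT : finGroupType) (K : {set gT}) :
  Ht (NSub_below K) <= Ht (NSub gT).
Proof. by apply: Ht_sub; apply/subsetP=> A; rewrite inE => /andP[]. Qed.

Lemma NSub_below_Ht_mono (gT : finGroupType) (K L : {set gT}) : K \subset L ->
  Ht (NSub_below K) <= Ht (NSub_below L).
Proof.
move=> KL; apply: Ht_sub; apply/subsetP=> A; rewrite !inE => /andP[-> AK] /=.
exact: subset_trans AK KL.
Qed.

Lemma NSub_below_Ht_lt (gT : finGroupType) (K L : {set gT}) : K \in NSub gT ->
  L \in NSub gT -> K \proper L -> Ht (NSub_below K) < Ht (NSub_below L).
Proof.
move=> KN LN KL; have := @Ht_below_lt _ _ (NSub gT) K L.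
by rewrite /NSub_below; apply; rewrite ?ltEproper.
Qed.

Lemma level_mono r E F : E \subset F -> level r E <= level r F.
Proof.
move=> sEF; apply: leq_add;
  first by case: drops (@drops_mono r _ _ sEF) => // ->.
by rewrite -!subn1 leq_sub2r // NSub_below_Ht_mono ?stab_mono.
Qed.

Lemma level_eq r E F : E \subset F ->
    eqv E -> lcomp E -> rcomp E -> eqv F -> lcomp F -> rcomp F ->
    level r F <= level r E ->
  (drops r F -> drops r E) /\ stab (std r) F \subset stab (std r) E.
Proof.
move=> sEF eE lE cE eF lF cF le; have hd := @drops_mono r _ _ sEF.
have hs := stab_mono (std r) sEF; have hm := NSub_below_Ht_mono hs.
have nE := stab_normal (pattern_std r) eE lE cE.
have nF := stab_normal (pattern_std r) eF lF cF.
have K0 : 0 < Ht (NSub_below (stab (std r) E)).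
  by apply: (@Ht_gt0 _ _ _ (stab (std r) E)); rewrite inE nE subxx.
have [|ha _ hh] := @invariant_split false _ _ false false _ _ hd id K0 hm.
  by rewrite /= !addn0.
split=> //; apply/negPn/negP=> nFE.
have := NSub_below_Ht_lt nE nF; rewrite properE hs => /(_ nFE).
by rewrite ltnNge hh.
Qed.

Lemma level_max r E : r <= n -> level r E <= Ht (NSub 'S_r).
Proof.
move=> rn; have -> : Ht (NSub 'S_r) = Ht (NSub {perm 'I_#|(std r).2|}).
  by rewrite -/(prank (std r)) prank_std.
have := NSub_below_Ht_le (stab (std r) E).
have : 0 < Ht (NSub {perm 'I_#|(std r).2|}) by apply: Ht_gt0 (NSub1 _).
rewrite /level; move: (Ht (NSub _)) (Ht (NSub_below _)) => a b.
by case: drops; lia.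
Qed.

Lemma Ht_Cong_le : Ht (Cong (@mul_part n)) <= (\sum_(r < n) Ht (NSub 'S_r.+1)
  + 2).+1.
Proof.
apply: (@Ht_rank_le _ _ _ total) => [E F | E _]; last first.
  apply: leq_add; last by case: joins_upper; case: joins_lower.
  by apply: leq_sum => r _; apply: level_max.
move=> /CongP[eE lE cE] /CongP[eF lF cF] EF.
have /proper_sub sEF : E \proper F by rewrite -ltEproper.
have hl r : level r E <= level r F by apply: level_mono.
have hu := @joins_upper_mono _ _ sEF; have hw := @joins_lower_mono _ _ sEF.
have hs : \sum_(r < n) level r.+1 E <= \sum_(r < n) level r.+1 F.
  by apply: leq_sum => r _; apply: hl.
rewrite ltnNge; apply/negP=> le.
have [hsF hj] : \sum_(r < n) level r.+1 F <= \sum_(r < n) level r.+1 E /\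
    (joins_upper F -> joins_upper E) /\ (joins_lower F -> joins_lower E).
  move: le hs hu hw; rewrite /total;
    move: (\sum_(r < n) _) (\sum_(r < n) _) => a b.
  case: (joins_upper E); case: (joins_upper F); case: (joins_lower E);
    case: (joins_lower F) => le hs hu hw; move: le; rewrite /= => le;
    first [by have := hu isT | by have := hw isT | by split;
      [lia | split=> // _; lia]
          | by split; lia].
have eq_level r : r < n -> level r.+1 F <= level r.+1 E.
  move=> rn; have [_ /esym] := @leqif_sum _ xpredT
      (fun r : 'I_n => level r.+1 E == level r.+1 F)
      (fun r : 'I_n => level r.+1 E) (fun r : 'I_n => level r.+1 F)
      (fun (r : 'I_n) _ => leqif_eq (hl r.+1)).
  rewrite eqn_leq hs hsF => /forallP/(_ (Ordinal rn))/eqP /= ->.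
  exact: leqnn.
have lv r : 0 < r -> r <= n ->
    (drops r F -> drops r E) /\ stab (std r) F \subset stab (std r) E.
  by case: r => // r _ rn; apply: level_eq => //; apply: eq_level.
have sFE : F \subset E.
  by apply: invariants_determine2 => // [r r0 rn|r r0 rn||];
    [apply: (lv r r0 rn).1 | apply: (lv r r0 rn).2 | apply: hj.1 | apply: hj.2].
by move: EF; rewrite ltEproper properE sFE andbF.
Qed.

End TwoSided.


(** * Two-sided congruences: a long chain *)

Section Syntactic.
Variable n : nat.
Local Notation PM := (partition_monoid n).
Local Notation pat := ({set {set 'I_n}} * {set {set 'I_n}})%type.
Local Notation rank x := (prank (upat x)).
Implicit Types (x y z a b : PM) (E F : {set PM * PM}) (r : nat).

Section Cosets.
Variable d : pat.
Hypothesis pd : pattern d.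
Local Notation perm_d := {perm 'I_#|d.2|}.
Implicit Types (p q k : perm_d) (K L : {group perm_d}).

(** The group [theta d] is an H-class: a product through its identity can only
    fall in it if both halves do. *)
Lemma theta_cut a b p : a ** theta d 1%g ** b = theta d p ->
  (exists q, a ** theta d 1%g = theta d q) /\ (exists q,
    theta d 1%g ** b = theta d q).
Proof.
move=> e; have e' : a ** (theta d 1%g ** b) = theta d p by rewrite mulA.
have u1 : upat (theta d 1%g) = d by apply: upat_theta.
have l1 : upat (theta d 1%g)^~* = d by apply: upat_theta_star.
have up : upat (theta d p) = d by apply: upat_theta.
have lp : upat (theta d p)^~* = d by apply: upat_theta_star.
have ra : rank (a ** theta d 1%g) <= prank d.
  by have := prank_mul_ler a (theta d 1%g); rewrite u1.
have rb : rank (theta d 1%g ** b) <= prank d.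
  by have := prank_mul_le (theta d 1%g) b; rewrite u1.
have ra' : prank d <= rank (a ** theta d 1%g).
  by have := prank_mul_le (a ** theta d 1%g) b; rewrite e up.
have rb' : prank d <= rank (theta d 1%g ** b).
  by have := prank_mul_ler a (theta d 1%g ** b); rewrite e' up.
split; apply: theta_onto => //.
- have : upat (a ** theta d 1%g ** b) = upat (a ** theta d 1%g).
    by apply: upat_mul; rewrite e up.
  by rewrite e up => <-.
- by have := @upat_mull n a (theta d 1%g); rewrite u1 l1; apply.
- by have := @upat_mul n (theta d 1%g) b; rewrite u1; apply.
have : upat (a ** (theta d 1%g ** b))^~* = upat (theta d 1%g ** b)^~*.
  by apply: upat_mull; rewrite e' up.
by rewrite e' lp => <-.
Qed.

(** By [theta_cut] the middle factor is multiplied by group elements on both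
    sides, and normality carries the discrepancy to the left. *)
Lemma coset_label_middle K p q a b : [set: perm_d] \subset 'N(K)%g ->
    (p * q^-1)%g \in K ->
  coset_label K (a ** theta d p ** b) = coset_label K (a ** theta d q ** b).
Proof.
move=> nK.
have half s t : (s * t^-1)%g \in K ->
  (exists g, a ** theta d s ** b = theta d g) ->
    coset_label K (a ** theta d s ** b) = coset_label K (a ** theta d t ** b).
  move=> stK [g eg].
  have [] := @theta_cut (a ** theta d s) b g.
    by rewrite -(mulA a) thetaM // mulg1.
  move=> [u]; rewrite -mulA thetaM // mulg1 => eu [v ev].
  have et : a ** theta d t ** b = theta d (u * (s^-1 * t) * v)%g.
    have -> : theta d t = theta d s ** theta d (s^-1 * t)%g ** theta d 1%g.
      by rewrite !thetaM // mulKVg mulg1.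
    by rewrite !mulA eu -mulA ev !thetaM.
  have es : a ** theta d s ** b = theta d (u * v)%g.
    have -> : theta d s = theta d s ** theta d 1%g by rewrite thetaM // mulg1.
    by rewrite mulA -mulA ev eu thetaM.
  rewrite es et !coset_label_theta //; congr Some; apply/rcoset_eqP.
  have -> : (u * v = (t^-1 * s) ^ u^-1 * (u * (s^-1 * t) * v))%g.
    by rewrite conjgE invgK !mulgA mulgKV mulgK mulgKV.
  rewrite mem_rcoset mulgK memJ_norm ?(subsetP nK) ?inE //.
  have -> : (t^-1 * s = (s * t^-1) ^ s)%g by rewrite conjgE !mulgA mulVg mul1g.
  by rewrite memJ_norm ?(subsetP nK) ?inE.
move=> pqK; have qpK : (q * p^-1)%g \in K by rewrite -groupV invMg invgK.
have [[g eg]|np] := coset_labelP K (a ** theta d p ** b).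
  by apply: half => //; exists g.
have [[g eg]|nq] := coset_labelP K (a ** theta d q ** b).
  by apply/esym/half => //; exists g.
by rewrite np nq.
Qed.

(** The syntactic congruence of the partition of the group [theta d] into cosets
    of [A], the rest of the monoid forming one more class. *)
Definition syn (A : {set perm_d}) : {set PM * PM} :=
  [set p | [forall a, forall b,
     coset_label A (a ** p.1 ** b) == coset_label A (a ** p.2 ** b)]].

Lemma synP (A : {set perm_d}) x y : reflect
  (forall a b, coset_label A (a ** x ** b) = coset_label A (a ** y ** b))
  ((x, y) \in syn A).
Proof.
rewrite inE; apply: (iffP forallP) => H a; last by apply/forallP=> b;
  apply/eqP/H.
by move=> b; have /forallP/(_ b)/eqP := H a.
Qed.

Lemma syn_cong (A : {set perm_d}) :
  [/\ eqv (syn A), lcomp (syn A) & rcomp (syn A)].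
Proof.
split; first split=> [x|x y /synP xy|x y z /synP xy /synP yz].
- exact/synP.
- by apply/synP=> a b; rewrite xy.
- by apply/synP=> a b; rewrite xy.
- by move=> c x y /synP xy; apply/synP=> a b; rewrite !mulA.
by move=> c x y /synP xy; apply/synP=> a b; rewrite !mulA -!(mulA _ c b).
Qed.

Lemma syn_sub K L : K \subset L -> syn K \subset syn L.
Proof.
move=> sKL; apply/subsetP=> -[x y] /synP xy; apply/synP=> a b.
exact: (coset_label_coarsen pd sKL (xy a b)).
Qed.

Lemma syn_theta K k : [set: perm_d] \subset 'N(K)%g ->
  ((theta d 1%g, theta d k) \in syn K) = (k \in K).
Proof.
move=> nK; apply/synP/idP=> [/(_ (theta d 1%g) (theta d 1%g)) | kK a b].
  by rewrite !thetaM // !mulg1 !mul1g; apply: theta1_label.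
by apply: coset_label_middle; rewrite ?mul1g ?groupV.
Qed.

End Cosets.

Definition ideal r : {set PM * PM} :=
  [set p | (p.1 == p.2) || (rank p.1 <= r) && (rank p.2 <= r)].

Lemma idealE r x y : ((x, y) \in ideal r) =
  (x == y) || (rank x <= r) && (rank y <= r).
Proof. by rewrite inE. Qed.

Lemma ideal_cong r : ideal r \in Cong (@mul_part n).
Proof.
apply/CongP; split; first split=> [x|x y|x y z]; rewrite ?idealE ?eqxx //.
- by rewrite eq_sym andbC.
- case/orP=> [/eqP->//|/andP[xr yr]].
  by case/orP=> [/eqP<-|/andP[_ zr]]; rewrite ?xr ?yr ?zr orbT.
- move=> a x y; rewrite !idealE => /orP[/eqP->|/andP[xr yr]];
    first by rewrite eqxx.
  by rewrite !(leq_trans (prank_mul_ler _ _)) ?orbT.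
move=> a x y; rewrite !idealE => /orP[/eqP->|/andP[xr yr]];
  first by rewrite eqxx.
by rewrite !(leq_trans (prank_mul_le _ _)) ?orbT.
Qed.

(** In rank 0, factors on either side change lower patterns independently of the
    upper ones, so this is a congruence; it lies strictly between equality and
    the collapse of the minimal ideal. *)
Definition lower_classes : {set PM * PM} :=
  [set p | (p.1 == p.2) ||
           [&& rank p.1 == 0, rank p.2 == 0 & upat p.1^~* == upat p.2^~*]].

Lemma lower_classesE x y : ((x, y) \in lower_classes) =
  (x == y) || [&& rank x == 0, rank y == 0 & upat x^~* == upat y^~*].
Proof. by rewrite inE. Qed.

Lemma upat_mul_eq a x y : upat x = upat y -> upat (a ** x) = upat (a ** y).
Proof.
have le z w : upat z = upat w -> rank (a ** w) <= rank (a ** z).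
  move=> ezw; have -> : a ** w = a ** z ** (z^~* ** w).
    by rewrite -mulA star_cancel.
  exact: prank_mul_le.
move=> exy; have -> : a ** y =
  a ** x ** (x^~* ** y) by rewrite -mulA star_cancel.
apply/esym/upat_mul; rewrite -mulA star_cancel //; exact: le (esym exy).
Qed.

Lemma lower_classes_cong : lower_classes \in Cong (@mul_part n).
Proof.
apply/CongP; split; first split=> [x|x y|x y z];
  rewrite ?lower_classesE ?eqxx //.
- case/orP=> [/eqP->|/and3P[-> -> /eqP->]]; first by rewrite eqxx.
  by rewrite eqxx orbT.
- case/orP=> [/eqP->//|/and3P[x0 y0 /eqP lxy]].
  by case/orP=> [/eqP<-|/and3P[_ z0 /eqP lyz]];
    rewrite x0 ?y0 ?z0 ?lxy ?lyz eqxx orbT.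
- move=> a x y; rewrite !lower_classesE =>
    /orP[/eqP->|/and3P[/eqP x0 /eqP y0 /eqP lxy]].
    by rewrite eqxx.
  by rewrite !prank0_mull // !rank0_mull // lxy !eqxx orbT.
move=> a x y; rewrite !lower_classesE =>
  /orP[/eqP->|/and3P[/eqP x0 /eqP y0 /eqP lxy]].
  by rewrite eqxx.
by rewrite !prank0_mulr // !starM (upat_mul_eq _ lxy) !eqxx orbT.
Qed.

Lemma climb_rank0 : 2 <= n ->
  climb (Cong (@mul_part n)) 2 [set p | p.1 == p.2] (ideal 0).
Proof.
move=> n2; have pd0 := pattern_std n 0; have d0 := prank_std (leq0n n).
have [x [y [ux uy nxy]]] := row_nontrivial n2 pd0 d0.
have lxy : upat x^~* <> upat y^~*.
  by move=> lxy; apply/nxy/rank0_ext; rewrite ?ux ?uy.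
apply: (@climb_trans _ _ _ 1 1 _ lower_classes); apply: climb_lt.
- apply/CongP; split; first split=> [z|z t|z t w]; rewrite ?inE //=.
  + by rewrite eq_sym.
  + by move=> /eqP->.
  + by move=> a z t; rewrite !inE /= => /eqP->.
  by move=> a z t; rewrite !inE /= => /eqP->.
- exact: lower_classes_cong.
- rewrite ltEproper; apply/properP; split.
    by apply/subsetP=> -[z t]; rewrite lower_classesE inE /= => ->.
  exists (x^~*, y^~*); first by rewrite lower_classesE !prank_star !starK ux
    uy d0 !eqxx orbT.
  by rewrite inE /=; apply/eqP=> /(can_inj (@starK n)).
- exact: lower_classes_cong.
- exact: ideal_cong.
rewrite ltEproper; apply/properP; split.
  apply/subsetP=> -[z t]; rewrite lower_classesE idealE !leqn0.
  by case/orP=> [->//|/and3P[-> -> _]]; rewrite orbT.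
exists (x, y); first by rewrite idealE ux uy d0 orbT.
by rewrite lower_classesE; apply/norP; split;
  [apply/eqP | apply/negP=> /and3P[_ _ /eqP]].
Qed.

Lemma climb_ideal r : r < n ->
  climb (Cong (@mul_part n)) (Ht (NSub 'S_r.+1)) (ideal r) (ideal r.+1).
Proof.
move=> rn; pose d := std n r.+1.
have pd : pattern d by apply: pattern_std.
have rd : prank d = r.+1 by rewrite prank_std.
have -> : Ht (NSub 'S_r.+1) = Ht (NSub {perm 'I_#|d.2|}).
  by rewrite -/(prank d) rd.
have [C [/subsetP sC cC <-]] := Ht_attained (NSub {perm 'I_#|d.2|}).
have fC A : A \in C -> exists H : {group {perm 'I_#|d.2|}},
    A = H /\ [set: {perm 'I_#|d.2|}] \subset 'N(H)%g.
  by move/sC/NSubP.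
pose f (A : {set {perm 'I_#|d.2|}}) := syn A :&: ideal r.+1.
have sII : ideal r \subset ideal r.+1.
  apply/subsetP=> -[x y]; rewrite !idealE => /orP[->//|/andP[xr yr]].
  by rewrite !leqW ?orbT.
have theta_ideal k x : rank x <= r.+1 -> (theta d k, x) \in ideal r.+1.
  by move=> xr; rewrite idealE upat_theta // rd leqnn xr orbT.
have fmem A k : A \in C -> ((theta d 1%g, theta d k) \in f A) = (k \in A).
  move=> /fC[H [-> nH]]; rewrite in_setI syn_theta // theta_ideal ?andbT //.
  by rewrite upat_theta // rd.
apply: (@climb_image _ _ _ _ f) => //; first exact: ideal_cong.
- move=> A AC; split.
  + have [[rA sA tA] lA cA] := syn_cong A.
    have [[rE sE tE] lE cE] := CongP _ (ideal_cong r.+1).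
    apply/CongP; split; first split=> [x|x y|x y z].
    * by rewrite in_setI rA rE.
    * by rewrite !in_setI => /andP[/sA-> /sE->].
    * by rewrite !in_setI => /andP[xA xE] /andP[yA yE];
        rewrite (tA _ _ _ xA yA) (tE _ _ _ xE yE).
    * by move=> a x y; rewrite !in_setI => /andP[/lA-> /lE->].
    by move=> a x y; rewrite !in_setI => /andP[/cA-> /cE->].
  + rewrite subsetI sII andbT; apply/subsetP=> -[x y]; rewrite idealE.
    case/orP=> [/eqP->|/andP[xr yr]];
      first by have [[rA _ _] _ _] := syn_cong A.
    have none z a b : rank z <= r -> upat (a ** z ** b) != d.
      move=> zr; apply: contraTneq isT => e.
      have := leq_trans (prank_mul_le _ b) (leq_trans (prank_mul_ler a z) zr).
      by rewrite e rd ltnn.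
    by apply/synP=> a b; rewrite !coset_label_none ?none.
  rewrite properEneq subsetIr andbT; apply/eqP=> e.
  have : (theta d 1%g, floor (n := n) id) \in f A.
    by rewrite e theta_ideal // prank_floor.
  rewrite in_setI => /andP[/synP/(_ (theta d 1%g) (theta d 1%g)) + _].
  rewrite !thetaM // coset_label_theta // coset_label_none //.
  apply: contraTneq isT => e1;
    have := prank_mul_le (theta d 1%g ** floor id) (theta d 1%g).
  by rewrite e1 rd prank0_mull ?prank_floor.
- by move=> A B /fC[H [-> _]] /fC[L [-> _]] HL; apply/setSI/syn_sub.
by move=> A B AC BC eAB; apply/setP=> k; rewrite -!fmem // eAB.
Qed.

Lemma Ht_Cong_ge : 2 <= n -> \sum_(r < n) Ht (NSub 'S_r.+1) +
  3 <= Ht (Cong (@mul_part n)).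
Proof.
move=> n2.
have main j : j <= n ->
    climb (Cong (@mul_part n)) (\sum_(r < j) Ht (NSub 'S_r.+1)) (ideal 0)
      (ideal j).
  elim: j => [|j IHj] jn; first by rewrite big_ord0;
    apply/climb_refl/ideal_cong.
  by rewrite big_ord_recr; apply: climb_trans (IHj (ltnW jn)) (climb_ideal jn).
have := climb_lt_Ht (climb_trans (climb_rank0 n2) (main n (leqnn n))).
by rewrite add2n addn3.
Qed.

End Syntactic.

Lemma Ht_Cong n : 2 <= n ->
  Ht (Cong (@mul_part n)) = \sum_(r < n) Ht (NSub 'S_r.+1) + 3.
Proof.
by move=> n2; apply/eqP; rewrite eqn_leq Ht_Cong_ge // andbT addn3 -addn2
  Ht_Cong_le.
Qed.

Lemma sum_Ht_NSub n : 4 <= n -> \sum_(r < n) Ht (NSub 'S_r.+1) = 3 * n - 2.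
Proof.
elim: n => // n IHn; rewrite leq_eqVlt => /orP[/eqP <-|n4].
  by rewrite !big_ord_recr big_ord0 /= !Ht_NSub_Sym.
rewrite big_ord_recr /= IHn // Ht_NSub_Sym leqNgt n4 /=.
lia.
Qed.

Theorem mainTheorem3 (n : nat) :
  (2 <= n ->
     Ht (LCong (@mul_part n)) = Ht (RCong (@mul_part n)) /\
     Ht (RCong (@mul_part n)) =
       bell n + \sum_(0 <= r < n.+1) \sum_(r <= k < n.+1)
                  stirling2 n k * 'C(k, r) * Ht (SubG [set: 'S_r]%G)) /\
  (4 <= n -> Ht (Cong (@mul_part n)) = 3 * n + 1).
Proof.
split=> [n2|n4]; first by split; [apply: Ht_LCong | apply: Ht_RCong].
by rewrite Ht_Cong ?sum_Ht_NSub //; lia.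
Qed.
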